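(* Let $\alpha\in(0,1]$ be a constant and let $S$ be a set of $n$ points in general position in the plane with $\overline{cr}(S)/\binom{n}{4}=\alpha$. Then the Voronoi polynomial $p_V(z)=\sum_{k=1}^{n-1} v_k z^{k-1}$ of $S$ has a root $\zeta$ with $|1-\zeta|\in o\!\left(\frac{\log n}{n}\right)$ (as $n\to\infty$).
   Context: General position means no three points of $S$ are collinear and no four points of $S$ are cocircular. $v_k$ is the number of vertices of the order-$k$ Voronoi diagram of $S$ (the subdivision of the plane into cells whose points share the same set of $k$ nearest points of $S$). $\overline{cr}(S)$ is the number of crossing pairs of edges in the straight-line drawing of $K_n$ on $S$ (equivalently, the number of convex quadrilaterals with vertices in $S$). *)

(* Defs.v *)
From mathcomp Require Import all_boot all_order all_algebra finmap.
From mathcomp Require Import complex.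
From mathcomp Require Import all_classical all_reals all_analysis.

Set Implicit Arguments.
Unset Strict Implicit.
Unset Printing Implicit Defensive.

Import Order.TTheory GRing.Theory Num.Theory.
Import numFieldNormedType.Exports.

Local Open Scope classical_set_scope.
Local Open Scope ring_scope.

Section PointSets.
Variable R : realType.
Local Notation plane := (R * R)%type.

(* The library norm on [R * R] is the max norm, so the Euclidean distance is
   written out; both induce the same topology, hence the same [closure]. *)
Definition dist (p q : plane) : R :=
  Num.sqrt ((p.1 - q.1) ^+ 2 + (p.2 - q.2) ^+ 2).

Definition collinear (T : {fset plane}) : Prop :=
  exists a b c : R, (a, b) <> (0, 0) /\
    forall p, p \in T -> a * p.1 + b * p.2 = c.

Definition cocircular (T : {fset plane}) : Prop :=
  exists (o : plane) (r : R), 0 < r /\ forall p, p \in T -> dist o p = r.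

Definition general_position (S : {fset plane}) : Prop :=
  (forall T : {fset plane}, (T `<=` S)%fset -> #|` T| = 3%N -> ~ collinear T) /\
  (forall T : {fset plane}, (T `<=` S)%fset -> #|` T| = 4%N -> ~ cocircular T).

Definition ksubsets (K : choiceType) (A : {fset K}) (k : nat) :
    {fset {fset K}} :=
  [fset T in fpowerset A | #|` T| == k]%fset.

(* The points whose set of [#|` T|] nearest points of [S] is exactly [T]. *)
Definition voronoi_cell (S T : {fset plane}) : set plane :=
  [set x | forall p q, p \in T -> q \in (S `\` T)%fset -> dist x p < dist x q].

(* A vertex of the subdivision is a point where at least three cells meet. *)
Definition voronoi_vertex (S : {fset plane}) (k : nat) : set plane :=
  [set x | (3 <= #|` [fset T in ksubsets S k
                        | `[< closure (voronoi_cell S T) x >]]%fset|)%N].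

(* [fset_set] sends infinite sets to the empty one, which is harmless here:
   a vertex is equidistant from three non-collinear points of [S], so there
   are finitely many vertices. *)
Definition num_voronoi_vertices (S : {fset plane}) (k : nat) : nat :=
  #|` fset_set (voronoi_vertex S k)|.

Definition voronoi_poly (S : {fset plane}) : {poly R[i]} :=
  \sum_(1 <= k < #|` S|) (num_voronoi_vertices S k)%:R *: 'X^(k.-1).

(* The straight-line edge of [K_n] joining the two elements of [e], without
   its endpoints. *)
Definition edge_interior (e : {fset plane}) : set plane :=
  [set x | exists p q : plane, [/\ p != q, e = [fset p; q]%fset &
     exists2 t : R, 0 < t < 1 &
       x = ((1 - t) * p.1 + t * q.1, (1 - t) * p.2 + t * q.2)]].

(* Two edges with a common endpoint have disjoint interiors when no three
   points of [S] are collinear, so they are never counted. *)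
Definition crossing_number (S : {fset plane}) : nat :=
  #|` [fset P in ksubsets (ksubsets S 2) 2
      | `[< exists x : plane, forall e, e \in P -> edge_interior e x >]]%fset|.

End PointSets.

(* Main.v *)
Require Import Defs.
From mathcomp Require Import all_boot all_order all_algebra finmap.
From mathcomp Require Import complex.
From mathcomp Require Import all_classical all_reals all_analysis.
From mathcomp Require Import cyclic separable cyclotomic ring lra zify.
Import Order.TTheory GRing.Theory Num.Theory.
Import numFieldNormedType.Exports.
Local Open Scope classical_set_scope.
Local Open Scope ring_scope.
Local Open Scope complex_scope.

Set Implicit Arguments.
Unset Strict Implicit.
Unset Printing Implicit Defensive.

(** A triple T of points whose circumcircle encloses x_T points of S yields a
    vertex of the Voronoi diagrams of orders x_T + 1 and x_T + 2 and of no other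
    order, so p_V = (1 + z) f with f = sum_T z^(x_T).  A root of f lies within
    O(1/n) of 1, for the following reason.

    Put N = n - 3.  Writing f(1+u)/f(1) = prod_j (1 + a_j u), suppose that no root
    is within 2r of 1, so that |a_j| <= 1/(2r).  On |u| = r the function
    log |f(1+u)/f(1)| is at most N r because the coefficients of f are
    nonnegative, and the Borel-Caratheodory estimate for its second Taylor
    coefficient gives - Re sum_j a_j^2 <= 4 N / r.  The left-hand side is
    Var X - E X, where X = x_T for a uniformly random T.

    On the other hand Var X >= c N^2.  Five points lifted to the paraboloid
    have a Radon partition of type (2,3), so exactly four of the ten circles
    through three of them separate the other two; hence
    sum_T x_T (N - x_T) = 4 C(n,5).  In a set of four points between one and three
    of the points lie in the circle through the others.  Summed over the
    4-subsets of a 5-set this count is 4 plus an even number, hence between 6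
    and 14, so that E X lies between 0.3 N and 0.7 N. *)

Local Notation Re := (@complex.Re _).
Local Notation Im := (@complex.Im _).

(** * A Borel-Caratheodory estimate *)

Section ComplexModulus.
Variable R : realType.
Implicit Types x y z : R[i].

(** The squared modulus takes values in [R] and is polynomial in the coordinates, so real logarithms
    and real arithmetic apply to it directly. *)
Definition normsq z : R := Re z ^+ 2 + Im z ^+ 2.

Lemma normsqM x y : normsq (x * y) = normsq x * normsq y.
Proof. by case: x y => [a b] [c d]; rewrite /normsq /=; ring. Qed.

Lemma normsq1 : normsq 1 = 1.
Proof. by rewrite /normsq /= expr1n expr0n addr0. Qed.

Lemma normsqX x n : normsq (x ^+ n) = normsq x ^+ n.
Proof. by elim: n => [|n IH]; rewrite ?expr0 ?normsq1 // !exprS normsqM IH. Qed.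

Lemma normsq_ge0 x : 0 <= normsq x.
Proof. by rewrite addr_ge0 ?sqr_ge0. Qed.

Lemma normsq_eq0 x : (normsq x == 0) = (x == 0).
Proof.
rewrite /normsq paddr_eq0 ?sqr_ge0 // !sqrf_eq0.
by case: x => a b; rewrite eq_complex.
Qed.

Lemma normsqV x : normsq x^-1 = (normsq x)^-1.
Proof.
have [->|x0] := eqVneq x 0; first by rewrite invr0 /normsq /= expr0n addr0 invr0.
by apply: (mulfI (_ : normsq x != 0)); rewrite ?normsq_eq0 // -normsqM !divff ?normsq1 ?normsq_eq0.
Qed.

Lemma Re_sqr_le_normsq x : Re x ^+ 2 <= normsq x.
Proof. by rewrite /normsq lerDl sqr_ge0. Qed.

Lemma normsq_conj x : (normsq x)%:C = x * x^*.
Proof. by case: x => a b; apply/eqP; rewrite eq_complex /normsq /=; apply/andP; split; apply/eqP; ring. Qed.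

Lemma ReD x y : Re (x + y) = Re x + Re y.
Proof. by case: x y => [a b] [c d]. Qed.

Lemma ReZ (t : R) x : Re (t%:C * x) = t * Re x.
Proof. by case: x => a b /=; rewrite mul0r subr0. Qed.

Lemma Re_sum (I : Type) (r : seq I) (P : pred I) (F : I -> R[i]) :
  Re (\sum_(i <- r | P i) F i) = \sum_(i <- r | P i) Re (F i).
Proof. by apply: (big_morph (@complex.Re R)) => // x y; rewrite ReD. Qed.

Lemma le_normsq_norm z (r : R) : 0 <= r -> (`|z| <= r%:C) = (normsq z <= r ^+ 2).
Proof.
move=> r0; rewrite normc_def lecR -/(normsq z) -{1}(ger0_norm r0) -sqrtr_sqr.
by rewrite ler_sqrt // sqr_ge0.
Qed.
End ComplexModulus.

(** * Taylor approximation of the logarithm of a squared modulus *)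

Section LogTaylor.
Variable R : realType.
Implicit Types x : R[i].

Lemma normsq_1D_ge x (t : R) : normsq x <= 1 / 4 -> 0 <= t <= 1 ->
  1 / 4 <= normsq (1 + t%:C * x).
Proof.
case: x => a b; rewrite /normsq /= => h /andP[t0 t1].
have ha : - (1 / 2) <= a by nra.
have hta : - (1 / 2) <= t * a by nra.
have := sqr_ge0 (t * b); nra.
Qed.

(** Taylor polynomial of degree [m] of log(1 + x). *)
Definition log_poly x (m : nat) : R[i] :=
  \sum_(l < m) ((-1) ^+ l / l.+1%:R)%:C * x ^+ l.+1.

(** Mean value theorem along the segment t x, 0 <= t <= 1. The geometric sum reduces the derivative
    of the difference to 2 Re (x w^m / (1 + t x)) with w = - t x; here |x| and |w| are at most 1/2
    and |1 + t x| is at least 1/2. *)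
Lemma ln_normsq_1D x (m : nat) : normsq x <= 1 / 4 ->
  `|ln (normsq (1 + x)) - 2 * Re (log_poly x m)| <= 2 / 2 ^+ m.
Proof.
move=> hx.
(* Q(t) = |1 + t x|^2 and P(t) = Re ([log_poly] (t x) m), written as real polynomials in t so that
   only real functions are differentiated. *)
pose Q : {poly R} := 1 + (2 * Re x) *: 'X + normsq x *: 'X^2.
pose P : {poly R} := \sum_(l < m) ((-1) ^+ l / l.+1%:R * Re (x ^+ l.+1)) *: 'X^(l.+1).
have QE t : Q.[t] = normsq (1 + t%:C * x).
  by rewrite /Q !hornerE /normsq; case: x {hx Q P} => a b /=; ring.
have PE : P.[1] = Re (log_poly x m).
  rewrite /P /log_poly Re_sum horner_sum; apply: eq_bigr => l _.
  by rewrite hornerZ hornerXn expr1n mulr1 ReZ.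
pose F := fun t : R => ln Q.[t] - 2 * P.[t].
pose dF := fun t : R => Q^`().[t] / Q.[t] - 2 * P^`().[t].
have dp (p : {poly R}) (t : R) : is_derive t (1 : R) (horner p : R -> R) p^`().[t].
  by apply: DeriveDef; [exact: derivable_horner | rewrite derivE derive1E].
have Fd (t : R) : 0 <= t <= 1 -> is_derive t (1 : R) F (dF t).
  move=> t01.
  have Qt : 0 < Q.[t].
    by rewrite QE; apply: lt_le_trans (normsq_1D_ge hx t01); rewrite divr_gt0.
  have d1 := is_derive1_ln Qt.
  have d2 := dp Q t.
  have d3 := dp P t.
  have d4 := is_derive1_comp d1 d2.
  have d5 : is_derive t (1 : R) (2 \*: horner P) (2 *: P^`().[t]) by apply: is_deriveZ.
  have -> : F = (@ln R \o horner Q) - (2 \*: horner P) by [].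
  by rewrite /dF (mulrC Q^`().[t]); exact: is_deriveB d4 d5.
have [t||c c01] := @MVT R F dF 0 1 ltr01.
- by move=> t01; apply: Fd; rewrite !ltW ?(itvP t01).
- apply: derivable_within_continuous => t t01.
  by apply: ex_derive; apply: Fd; rewrite !(itvP t01).
have c0 : 0 <= c by rewrite ltW ?(itvP c01).
have c1 : c <= 1 by rewrite ltW ?(itvP c01).
have Q1 : Q.[1] = normsq (1 + x) by rewrite QE mul1r.
have Q0 : Q.[0] = 1 by rewrite QE mul0r addr0 normsq1.
have P0 : P.[0] = 0.
  rewrite /P horner_sum big1 // => l _.
  by rewrite hornerZ hornerXn expr0n mulr0.
rewrite /F Q1 Q0 P0 PE ln1 mulr0 !subr0 mulr1 => ->.
(* Since y = 1 - w, the sum of the w^l for l < m is (1 - w^m) / y; subtracting it from 1 / y leaves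
   w^m / y. *)
pose y := 1 + c%:C * x; pose w := - (c%:C * x).
have hy : 1 / 4 <= normsq y by apply: normsq_1D_ge; rewrite ?c0.
have y0 : y != 0 by rewrite -normsq_eq0 gt_eqF //; apply: lt_le_trans hy; rewrite divr_gt0.
have QcE : Q^`().[c] / Q.[c] = 2 * Re (x / y).
  rewrite QE -/y; apply: (mulIf (_ : normsq y != 0)); rewrite ?normsq_eq0 //.
  rewrite divfK ?normsq_eq0 // -mulrA (mulrC (Re _)) -ReZ normsq_conj.
  have -> : y * y^* * (x / y) = x * y^* by field; exact: y0.
  rewrite /Q /y; case: (x) => a b; rewrite !poly.derivE !hornerE /normsq /=; ring.
have PcE : P^`().[c] = Re (x * (1 - w ^+ m) / y).
  have -> : x * (1 - w ^+ m) / y = \sum_(l < m) ((- 1) ^+ l * c ^+ l)%:C * x ^+ l.+1.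
    have yw : y = 1 - w by rewrite opprK.
    have -> : 1 - w ^+ m = y * \sum_(l < m) w ^+ l by rewrite yw -opprB subrX1 -mulNr opprB.
    rewrite mulrCA mulrAC divff // mul1r mulr_sumr; apply: eq_bigr => l _.
    by rewrite -exprMn mulN1r rmorphXn /= exprS mulrCA -exprMn rmorphN mulNr.
  rewrite Re_sum /P raddf_sum horner_sum; apply: eq_bigr => l _.
  rewrite /= poly.derivZ poly.derivXn /= hornerZ hornerMn hornerXn ReZ.
  by field; rewrite nat1r pnatr_eq0.
have dFc : dF c = 2 * Re (x * w ^+ m / y).
  rewrite /dF QcE PcE -mulrBr; congr (_ * _).
  apply/eqP; rewrite subr_eq -ReD; apply/eqP; congr (complex.Re _); field.
  exact: y0.
have hz : Re (x * w ^+ m / y) ^+ 2 <= (2 ^+ m)^-1 ^+ 2.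
  apply: le_trans (Re_sqr_le_normsq _) _.
  rewrite !normsqM normsqV normsqX.
  have hw : normsq w <= 1 / 4.
    have -> : normsq w = c ^+ 2 * normsq x.
      by rewrite /w; case: (x) => a b; rewrite /normsq /=; ring.
    have := normsq_ge0 x; nra.
  have -> : (2 ^+ m)^-1 ^+ 2 = (1 / 4) ^+ m :> R.
    by rewrite exprVn -exprM mulnC exprM -exprVn mul1r; congr (_^-1 ^+ _); ring.
  have hwm : normsq w ^+ m <= (1 / 4) ^+ m.
    by apply: lerXn2r; rewrite ?nnegrE ?normsq_ge0 ?divr_ge0.
  have wm0 : 0 <= normsq w ^+ m by rewrite exprn_ge0 ?normsq_ge0.
  rewrite ler_pdivrMr; last by apply: lt_le_trans hy; rewrite divr_gt0.
  have := normsq_ge0 x; nra.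
suff : `|2 * Re (x * w ^+ m / y)| <= 2 / 2 ^+ m by rewrite -dFc.
rewrite normrM ger0_norm // ler_pM2l //.
have i0 : 0 <= (2 ^+ m)^-1 :> R by rewrite invr_ge0 exprn_ge0.
by rewrite -sqrtr_sqr -(ger0_norm i0) -[leRHS]sqrtr_sqr ler_sqrt ?sqr_ge0.
Qed.
End LogTaylor.

(** * Primitive roots of unity and their power sums *)

Section RootsOfUnity.

(** In characteristic zero X^n - 1 is separable, so a closed field contains n distinct n-th roots of
    unity, and one of them is primitive. *)
Lemma closed_prim_root_exists (F : numClosedFieldType) n :
  (0 < n)%N -> {z : F | n.-primitive_root z}.
Proof.
pose p : {poly F} := 'X^n - 1; have [r Dp] := closed_field_poly_normal p.
move=> n_gt0; apply/sigW; rewrite (monicP _) ?monicXnsubC // scale1r in Dp.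
have rn1 : all n.-unity_root r by apply/allP=> z; rewrite -root_prod_XsubC -Dp.
have sz_r : (n < (size r).+1)%N.
  by rewrite -(size_prod_XsubC r id) -Dp size_XnsubC.
have [|z] := hasP (has_prim_root n_gt0 rn1 _ sz_r); last by exists z.
by rewrite -separable_prod_XsubC -Dp cyclotomic.separable_Xn_sub_1 // pnatr_eq0 -lt0n.
Qed.

Lemma sum_unity_root (F : fieldType) (n l : nat) (z : F) :
  n.-primitive_root z ->
  \sum_(k < n) (z ^+ k) ^+ l = if (n %| l)%N then n%:R else 0.
Proof.
move=> hz; rewrite (prim_order_dvd hz).
have -> : \sum_(k < n) (z ^+ k) ^+ l = \sum_(k < n) (z ^+ l) ^+ k.
  by apply: eq_bigr => k _; rewrite -!exprM mulnC.
case: eqVneq => [->|h1].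
  by under eq_bigr do rewrite expr1n; rewrite sumr_const card_ord.
apply: (mulfI (_ : z ^+ l - 1 != 0)); first by rewrite subr_eq0.
by rewrite -subrX1 mulr0 exprAC (prim_expr_order hz) expr1n subrr.
Qed.
End RootsOfUnity.

(** * The second coefficient estimate, with averages over roots of unity in place of integrals *)

Section BorelCaratheodory.
Variable R : realType.
Implicit Types b w : R[i].

Lemma unit_conj w : normsq w = 1 -> w^* = w^-1.
Proof.
move=> h; have : w * w^* = 1 by rewrite -normsq_conj h.
by move=> hw; apply: (mulfI (_ : w != 0)); rewrite ?hw ?divff // -normsq_eq0 h oner_eq0.
Qed.

Lemma Re_addC_conj z : (2 * Re z)%:C = z + z^*%C :> R[i].
Proof. by case: z => a c; apply/eqP; rewrite eq_complex /=; apply/andP; split; apply/eqP; ring. Qed.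

(* The weight [2 + w^2 + w^-2] is nonnegative on the unit circle and extracts
   the coefficient of degree two. *)
Lemma sum_kernel_log_poly (m : nat) (z b : R[i]) : (1 < m)%N ->
  (m.+3).-primitive_root z ->
  \sum_(k < m.+3) (2 + 2 * Re ((z ^+ k) ^+ 2))%:C * log_poly (b * z ^+ k) m
    = - (m.+3%:R / 2) * b ^+ 2.
Proof.
move=> m1 hz; set M := m.+3.
have uz k : normsq (z ^+ k) = 1.
  have h : normsq (z ^+ k) ^+ M = 1.
    by rewrite -normsqX exprAC (prim_expr_order hz) expr1n normsq1.
  by apply/eqP; rewrite -(@pexpr_eq1 _ _ M) ?normsq_ge0 // h.
(* The conjugate of w^2 is w^(-2) = w^(2M - 2), so that every exponent below is a natural number. *)
have WE (k : nat) : (2 + 2 * Re ((z ^+ k) ^+ 2))%:C = 2 + (z ^+ k) ^+ 2 + (z ^+ k) ^+ (2 * M - 2).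
  rewrite rmorphD /= Re_addC_conj addrA; congr (_ + _ + _).
    by rewrite (rmorph_nat (real_complex R)).
  rewrite unit_conj; last by rewrite normsqX uz expr1n.

  rewrite expfB; last by rewrite /M; lia.
  by rewrite [in RHS]exprAC (mulnC 2) exprM (prim_expr_order hz) !expr1n div1r.
rewrite /log_poly.
transitivity (\sum_(l < m) ((-1) ^+ l / l.+1%:R)%:C * b ^+ l.+1 *
   \sum_(k < M) (2 * (z ^+ k) ^+ l.+1 + (z ^+ k) ^+ l.+3 + (z ^+ k) ^+ (l.+1 + (2 * M - 2)))).
  under eq_bigr do rewrite mulr_sumr.
  rewrite exchange_big /=; apply: eq_bigr => l _; rewrite mulr_sumr.
  apply: eq_bigr => k _; rewrite WE exprMn exprD -[l.+3]/(2 + l.+1)%N exprD.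
  ring.
under eq_bigr => l _ do
  rewrite !big_split /= -mulr_sumr !(sum_unity_root _ hz).
have i1 : (1 < m)%N by [].
(* Only l = 1 survives. The exponents l + 1 and l + 3 lie strictly between 0 and M = m + 3, and 2M +
   l - 1 lies strictly between M and 3M, so it is a multiple of M only when it equals 2M. *)
rewrite (bigD1 (Ordinal i1)) //= big1 ?addr0.
  have -> : (M %| 2 + (2 * M - 2))%N by rewrite subnKC ?dvdn_mull.
  rewrite !gtnNdvd //= ?mulr0 ?add0r.
  have -> : (-1 / 2)%:C = - 1 / 2 :> R[i].
    by rewrite rmorphM rmorphN1 fmorphV (rmorph_nat (real_complex R)).
  by rewrite /M; field.
move=> l; rewrite -val_eqE /= => l1.
have lm := ltn_ord l.
have n3 : (M %| l.+1 + (2 * M - 2))%N = false.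
  apply/negP => /dvdnP [q].
  rewrite /M; case: q => [|[|[|q]]] hq; lia.
by rewrite n3 !gtnNdvd // /M ?mulr0 ?addr0 ?mulr0 //; lia.
Qed.

Lemma normsq_1D_gt0 (b : R[i]) : normsq b <= 1 / 4 -> 0 < normsq (1 + b).
Proof.
move=> hb; rewrite -[b]mul1r; apply: lt_le_trans (normsq_1D_ge hb _); last by rewrite lexx ler01.
by rewrite divr_gt0.
Qed.

Lemma ln_normsq_prod (s : seq R[i]) (F : R[i] -> R[i]) :
  {in s, forall b, 0 < normsq (F b)} ->
  0 < normsq (\prod_(b <- s) F b) /\
  ln (normsq (\prod_(b <- s) F b)) = \sum_(b <- s) ln (normsq (F b)).
Proof.
elim: s => [|b s IH] h; first by rewrite !big_nil normsq1 ln1.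
have [|p e] := IH; first by move=> c cs; apply: h; rewrite inE cs orbT.
have hb : 0 < normsq (F b) by apply: h; rewrite inE eqxx.
by rewrite !big_cons normsqM mulr_gt0 // lnM ?posrE // e.
Qed.

(** The logarithm of the squared product is summed over the M-th roots of unity with nonnegative
    weights of total 2M. The Taylor polynomials bound this sum from below by - M Re (sum b^2) up to
    a small error, the hypothesis bounds it from above by 2MA, and M cancels. *)
Lemma borel_caratheodory2 (s : seq R[i]) (A : R) :
  {in s, forall b, normsq b <= 1 / 4} ->
  (forall w, normsq w = 1 -> normsq (\prod_(b <- s) (1 + b * w)) <= expR A) ->
  - Re (\sum_(b <- s) b ^+ 2) <= 2 * A.
Proof.
move=> hs hA.
(* It is enough to allow a Taylor error that tends to 0 as m grows; 2^m > m makes it smaller than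
   any gap e. *)
suff H (m : nat) : (1 < m)%N -> - Re (\sum_(b <- s) b ^+ 2) <= 2 * A + 4 * (size s)%:R / 2 ^+ m.
  rewrite leNgt; apply/negP => hlt.
  set e := - Re (\sum_(b <- s) b ^+ 2) - 2 * A.
  have e0 : 0 < e by rewrite subr_gt0.
  pose m := (Num.truncn (4 * (size s)%:R / e)).+2.
  have := H m isT; apply/negP; rewrite -ltNge.
  have hm : 4 * (size s)%:R / e < 2 ^+ m.
    apply: (@lt_trans _ _ m%:R).
      by apply: lt_trans (truncnS_gt _) _; rewrite ltr_nat.
    by rewrite -natrX ltr_nat ltn_expl.
  rewrite -ltrBrDl -/e ltr_pdivrMr ?exprn_gt0 //.
  by move: hm; rewrite ltr_pdivrMr // [e * _]mulrC.
move=> m1; have [z hz] := closed_prim_root_exists R[i] (ltn0Sn m.+2).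
set M := m.+3.
have uz k : normsq (z ^+ k) = 1.
  have h : normsq (z ^+ k) ^+ M = 1.
    by rewrite -normsqX exprAC (prim_expr_order hz) expr1n normsq1.
  by apply/eqP; rewrite -(@pexpr_eq1 _ _ M) ?normsq_ge0 // h.
pose W (k : nat) : R := 2 + 2 * Re ((z ^+ k) ^+ 2).
have W0 k : 0 <= W k.
  have h : Re ((z ^+ k) ^+ 2) ^+ 2 <= 1.
    by apply: le_trans (Re_sqr_le_normsq _) _; rewrite normsqX uz expr1n.
  by rewrite /W; nra.
have WS : \sum_(k < M) W k = 2 * M%:R.
  rewrite /W big_split /= sumr_const card_ord -mulr_sumr -Re_sum.
  rewrite (sum_unity_root _ hz) gtnNdvd //= mulr0 addr0 mulr_natr.
  by [].
have LB b : b \in s ->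
  - M%:R * Re (b ^+ 2) - 4 * M%:R / 2 ^+ m <= \sum_(k < M) W k * ln (normsq (1 + b * z ^+ k)).
  move=> bs.
  have -> : - M%:R * Re (b ^+ 2) - 4 * M%:R / 2 ^+ m =
    \sum_(k < M) W k * (2 * Re (log_poly (b * z ^+ k) m) - 2 / 2 ^+ m).
    under eq_bigr do rewrite mulrBr.
    rewrite sumrB -mulr_suml WS.
    have -> : \sum_(k < M) W k * (2 * Re (log_poly (b * z ^+ k) m)) =
      2 * Re (\sum_(k < M) (W k)%:C * log_poly (b * z ^+ k) m).
      by rewrite Re_sum mulr_sumr; apply: eq_bigr => k _; rewrite ReZ; ring.
    rewrite (sum_kernel_log_poly _ m1 hz).
    have -> : - (m.+3%:R / 2) * b ^+ 2 = (- (M%:R / 2))%:C * b ^+ 2 :> R[i].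
      by rewrite rmorphN rmorphM fmorphV !(rmorph_nat (real_complex R)).
    by rewrite ReZ; field; rewrite expf_neq0.
  apply: ler_sum => k _; apply: ler_wpM2l => //.
  have := @ln_normsq_1D R (b * z ^+ k) m; rewrite normsqM uz mulr1.
  by move=> /(_ (hs _ bs)); rewrite ler_norml => /andP[h _]; lra.
have lnE k : 0 < normsq (\prod_(b <- s) (1 + b * z ^+ k)) /\
   ln (normsq (\prod_(b <- s) (1 + b * z ^+ k))) = \sum_(b <- s) ln (normsq (1 + b * z ^+ k)).
  apply: (ln_normsq_prod (F := fun b => 1 + b * z ^+ k)) => b bs.
  by apply: normsq_1D_gt0; rewrite normsqM uz mulr1 hs.
have UB : \sum_(k < M) W k * ln (normsq (\prod_(b <- s) (1 + b * z ^+ k))) <= 2 * M%:R * A.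
  rewrite -WS mulr_suml; apply: ler_sum => k _; apply: ler_wpM2l => //.
  by rewrite -[leRHS]expRK ler_ln ?posrE ?expR_gt0 ?hA // (lnE k).1.
have M0 : 0 < M%:R :> R by rewrite ltr0n.
rewrite -(ler_pM2l M0).
have : \sum_(b <- s) (- M%:R * Re (b ^+ 2) - 4 * M%:R / 2 ^+ m) <= 2 * M%:R * A.
  apply: le_trans UB.
  under [leRHS]eq_bigr do rewrite (lnE _).2 mulr_sumr.
  by rewrite exchange_big /= !big_seq; apply: ler_sum => b /LB.
rewrite sumrB -mulr_sumr -Re_sum big_const_seq count_predT iter_addr addr0 -mulr_natr.
lra.
Qed.
End BorelCaratheodory.

(** * Roots near 1 of a sum of monomials *)

Section GeneratingPolynomial.
Variable R : realType.

(** The first two derivatives at 1 give the power sums of the coefficients, and hence relate them to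
    factorial moments of the exponents. *)
Lemma prod_linear_derivs (F : fieldType) (s : seq F) :
  let P := \prod_(a <- s) (1 + a *: ('X - 1)) : {poly F} in
  [/\ P.[1] = 1, P^`().[1] = \sum_(a <- s) a &
      P^`()^`().[1] = (\sum_(a <- s) a) ^+ 2 - \sum_(a <- s) a ^+ 2].
Proof.
elim: s => [|a s [h0 h1 h2]] /=.
  by rewrite !big_nil !poly.derivE !hornerE expr0n subr0.
rewrite !big_cons; move: (\prod_(_ <- s) _ : {poly F}) h0 h1 h2 => P h0 h1 h2.
pose L : {poly F} := 1 + a *: ('X - 1); rewrite -/L.
have d1 : L^`() = a%:P.
  by rewrite /L poly.derivD poly.derivZ poly.derivB derivX -polyC1 !derivC add0r subr0 polyC1 alg_polyC.
have L1 : L.[1] = 1 by rewrite !hornerE subrr mulr0 addr0.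
split.
- by rewrite hornerM h0 L1 mul1r.
- by rewrite poly.derivM d1 hornerD !hornerM hornerC h0 h1 L1; ring.
rewrite poly.derivM d1 poly.derivD !poly.derivM derivC d1 mul0r add0r !hornerD !hornerM !hornerC.
rewrite h1 h2 L1.
ring.
Qed.

Variables (s : seq nat) (N : nat).
Let f : {poly R[i]} := \sum_(x <- s) 'X^x.
Let m : R := (size s)%:R.

(** The coefficients are nonnegative, so |f(1 + r w)| <= f(1 + r) <= m (1 + r)^N <= m exp(N r). *)
Lemma normsq_sumXn_le (r : R) (w : R[i]) :
  0 <= r -> {in s, forall x, (x <= N)%N} -> normsq w = 1 ->
  normsq f.[1 + r%:C * w] <= m ^+ 2 * expR (2 * N%:R * r).
Proof.
move=> r0 hs w1.
have h1 : `|1 + r%:C * w| <= (1 + r)%:C.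
  rewrite rmorphD; apply: le_trans (ler_normD _ _) _; rewrite normr1 lerD2l.
  rewrite le_normsq_norm // normsqM w1 mulr1.
  by rewrite /normsq /= expr0n addr0.
have h2 : `|f.[1 + r%:C * w]| <= (m * (1 + r) ^+ N)%:C.
  rewrite /f horner_sum; apply: le_trans (ler_norm_sum _ _ _) _.
  have -> : (m * (1 + r) ^+ N)%:C = \sum_(x <- s) ((1 + r) ^+ N)%:C.
    by rewrite big_const_seq count_predT iter_addr addr0 -mulr_natl rmorphM rmorph_nat.
  rewrite !big_seq; apply: ler_sum => x xs; rewrite hornerXn normrX.
  apply: (@le_trans _ _ ((1 + r) ^+ x)%:C).
    rewrite rmorphXn; apply: lerXn2r => //; rewrite nnegrE ?normr_ge0 //.
    by apply: le_trans h1.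
  by rewrite lecR ler_weXn2l ?lerDl ?hs.
have mr0 : 0 <= m * (1 + r) ^+ N by rewrite mulr_ge0 ?exprn_ge0 ?addr_ge0 ?ler0n.
move: h2; rewrite le_normsq_norm // => h2; apply: (le_trans h2).
rewrite exprMn ler_wpM2l ?sqr_ge0 // -exprM mulnC -natrM expRM_natl.
by apply: lerXn2r; rewrite ?nnegrE ?expR_ge0 ?addr_ge0 ?expR_ge1Dx.
Qed.

(** Writing f = m prod (1 + b (X - 1)) with b = 1 / (1 - z) over the roots z, the derivatives at 1
    show that the difference of moments on the left is - sum b^2. The bound on f over the circle of
    radius r then gives V r^2 <= 4 N r. *)
Lemma sumXn_root_near1 (r : R) :
  0 < r -> s != [::] -> {in s, forall x, (x <= N)%N} ->
  (forall z, root f z -> (2 * r) ^+ 2 <= normsq (1 - z)) ->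
  ((\sum_(x <- s) (x * x.-1)%:R) / m - ((\sum_(x <- s) x%:R) / m) ^+ 2) * r <= 4 * N%:R.
Proof.
move=> r0 sn0 hs hroot.
have m0 : 0 < m by rewrite ltr0n lt0n size_eq0.
have [t ft] := closed_field_poly_normal f.
have f1 : f.[1] = m%:C.
  rewrite horner_sum (eq_bigr (fun=> 1)); last by move=> x _; rewrite hornerXn expr1n.
  by rewrite big_const_seq count_predT iter_addr addr0 rmorph_nat.
have fn0 : f != 0 by apply/eqP => f0; move: f1; rewrite f0 horner0 => /eqP; rewrite eq_sym fmorph_eq0 gt_eqF.
have ht z : z \in t -> (2 * r) ^+ 2 <= normsq (1 - z).
  by move=> zt; apply: hroot; rewrite ft rootZ ?lead_coef_eq0 // root_prod_XsubC.
have ht1 z : z \in t -> 1 - z != 0.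
  move=> /ht h; rewrite -normsq_eq0 gt_eqF //; apply: lt_le_trans h.
  by rewrite exprn_gt0 // mulr_gt0.
pose a := [seq (1 - z)^-1 | z <- t].
have fE : f = m%:C *: \prod_(b <- a) (1 + b *: ('X - 1)).
  have e1 : \prod_(z <- t) ('X - z%:P) =
     (\prod_(z <- t) (1 - z)) *: \prod_(b <- a) (1 + b *: ('X - 1)).
    rewrite big_map -mul_polyC rmorph_prod -big_split /= !big_seq.
    apply: eq_bigr => z /ht1 hz.
    rewrite mulrDr mulr1 -scalerAr mul_polyC scalerA mulVf // scale1r.
    by rewrite polyCB polyC1; ring.
  have e2 : lead_coef f * \prod_(z <- t) (1 - z) = m%:C.
    rewrite -f1 [in RHS]ft hornerZ horner_prod; congr (_ * _).
    by apply: eq_bigr => z _; rewrite !hornerE.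
  by rewrite [LHS]ft e1 scalerA e2.
have [P0 P1 P2] := prod_linear_derivs a.
set P := \prod_(b <- a) _ in fE P0 P1 P2.
have S1 : \sum_(x <- s) x%:R = m%:C * \sum_(b <- a) b.
  rewrite -P1 -hornerZ -poly.derivZ -fE /f raddf_sum horner_sum /=.
  by apply: eq_bigr => x _; rewrite poly.derivXn hornerMn hornerXn expr1n.
have S2 : \sum_(x <- s) (x * x.-1)%:R = m%:C * ((\sum_(b <- a) b) ^+ 2 - \sum_(b <- a) b ^+ 2).
  rewrite -P2 -hornerZ -!poly.derivZ -fE /f raddf_sum raddf_sum horner_sum /=.
  apply: eq_bigr => x _; rewrite poly.derivXn derivMn poly.derivXn !hornerMn hornerXn expr1n.
  by rewrite mulnC mulrnA.
have mC0 : m%:C != 0 :> R[i] by rewrite fmorph_eq0 gt_eqF.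
set V := _ / m - _.
have VE : \sum_(b <- a) b ^+ 2 = (- V)%:C.
  have natC (g : nat -> nat) : (\sum_(x <- s) (g x)%:R : R)%:C = \sum_(x <- s) (g x)%:R.
    by rewrite rmorph_sum; apply: eq_bigr => x _; rewrite /= (rmorph_nat (real_complex R)).
  rewrite /V rmorphN rmorphB rmorphXn !rmorphM fmorphV /= (natC (fun x => (x * x.-1)%N)) (natC id) S1 S2.
  rewrite ![m%:C * _ / _]mulrAC !divff // !mul1r; ring.
(* Scaling by r turns the circle of radius r about 1 into the unit circle; the root-free disc of
   radius 2r makes |r b| <= 1/2. *)
pose c := [seq r%:C * b | b <- a].
have cE : \sum_(b <- c) b ^+ 2 = (- V * r ^+ 2)%:C.
  rewrite big_map; under eq_bigr do rewrite exprMn.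
  by rewrite -mulr_sumr VE rmorphM rmorphXn mulrC.
have cP w : \prod_(b <- c) (1 + b * w) = P.[1 + r%:C * w].
  rewrite /P horner_prod big_map; apply: eq_bigr => b _.
  by rewrite !hornerE; ring.
suff : - Re (\sum_(b <- c) b ^+ 2) <= 2 * (2 * N%:R * r).
  rewrite cE /= => h; have r0' := ltW r0.
  rewrite -(ler_pM2r r0); lra.
apply: borel_caratheodory2 => [b|w w1].
  move=> /mapP[_ /mapP[z /ht zt ->] ->]; rewrite normsqM normsqV.
  have hz : 0 < normsq (1 - z) by apply: lt_le_trans zt; rewrite exprn_gt0 // mulr_gt0.
  rewrite ler_pdivrMr // [normsq _%:C]/normsq /= expr0n /=; lra.
rewrite cP -(ler_pM2l (_ : 0 < m ^+ 2)) ?exprn_gt0 //.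
apply: le_trans (normsq_sumXn_le (ltW r0) hs w1).
rewrite -/f fE hornerZ normsqM [normsq m%:C]/normsq /= expr0n /= addr0.
by [].
Qed.
End GeneratingPolynomial.

(** * Circles through three of finitely many points *)

Lemma linear_dependency (F : fieldType) (I : finType) (k : nat) (A : {set I})
    (phi : I -> 'I_k -> F) : (k < #|A|)%N ->
  exists2 l : I -> F, (exists2 i, i \in A & l i != 0) &
    forall j, \sum_(i in A) l i * phi i j = 0.
Proof.
move=> kA; pose M : 'M[F]_(#|A|, k) := \matrix_(i, j) phi (enum_val i) j.
have : kermx M != 0.
  rewrite -mxrank_eq0 mxrank_ker -lt0n subn_gt0.
  by apply: leq_ltn_trans (rank_leq_col _) kA.
case/rowV0Pn => v /sub_kermxP vM /rV0Pn [i0 vi0].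
have A0 : enum_val i0 \in A := enum_valP i0.
(* Outside [A] the function takes an arbitrary value, which no sum over [A] sees. *)
exists (fun i => v 0 (enum_rank_in A0 i)).
  by exists (enum_val i0); rewrite ?enum_valK_in.
move=> j; rewrite (big_enum_val (fun i => v 0 (enum_rank_in A0 i) * phi i j)) /=.
have /matrixP/(_ 0 j) := vM; rewrite [in RHS]mxE => vMj; rewrite -[RHS]vMj mxE.
by apply: eq_bigr => i _; rewrite enum_valK_in mxE.
Qed.

Section SubsetSums.
Local Open Scope nat_scope.
Variable I : finType.

(** A set T with a point d outside it corresponds to Q = T + d with a marked element d. *)
Lemma exchange_sum_add1 (k : nat) (h : {set I} -> I -> nat) :
  \sum_(T : {set I} | #|T| == k) \sum_(d | d \notin T) h T d =
  \sum_(Q : {set I} | #|Q| == k.+1) \sum_(d in Q) h (Q :\ d) d.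
Proof.
rewrite !pair_big_dep /=.
rewrite (reindex_onto (fun u => (u.1 :\ u.2, u.2)) (fun u => (u.2 |: u.1, u.2))) /=.
  apply: eq_bigl => -[Q d] /=; rewrite !inE eqxx /= andbT.
  apply/andP/andP => [[/eqP hk /eqP [hQ]]|[/eqP hQ dQ]].
    have dQ : d \in Q by rewrite -hQ !inE eqxx.
    by rewrite (cardsD1 d) dQ hk.
  by rewrite finset.setD1K // eqxx; split => //; move: hQ; rewrite (cardsD1 d) dQ add1n => -[->].
by move=> [T d] /= /andP[_ dT]; rewrite finset.setU1K.
Qed.

Lemma exchange_sum_add2 (k : nat) (g : {set I} -> I -> I -> nat) :
  \sum_(T : {set I} | #|T| == k) \sum_(d | d \notin T) \sum_(e | e \notin d |: T) g T d e =
  \sum_(F : {set I} | #|F| == k.+2) \sum_(e in F) \sum_(d in F :\ e) g (F :\ e :\ d) d e.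
Proof.
rewrite (exchange_sum_add1 _ (fun T d => \sum_(e | e \notin d |: T) g T d e)).
rewrite -(exchange_sum_add1 _ (fun Q e => \sum_(d in Q) g (Q :\ d) d e)).
apply: eq_bigr => Q _; rewrite [RHS]exchange_big /=.
by apply: eq_bigr => d dQ; apply: eq_bigl => e; rewrite finset.setD1K.
Qed.
End SubsetSums.

(** Each unordered pair is counted twice; the enumeration order selects one of its two orderings. *)
Lemma even_sum_sym (I : finType) (A : {set I}) (h : I -> I -> nat) :
  (forall e d, h e d = h d e) ->
  exists w, (\sum_(e in A) \sum_(d in A :\ e) h e d = w.*2)%N.
Proof.
move=> hC; pose lt (d e : I) := (enum_rank d < enum_rank e)%N.
exists (\sum_(e in A) \sum_(d in A | lt d e) h e d)%N.
rewrite -addnn.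
have {1}-> : (\sum_(e in A) \sum_(d in A | lt d e) h e d =
           \sum_(e in A) \sum_(d in A | lt e d) h e d)%N.
  rewrite (exchange_big_dep (mem A)) /=; last by move=> e d _ /andP[].
  by apply: eq_bigr => d dA; apply: eq_big => [e|e _]; [rewrite dA andbC | exact: hC].
rewrite -big_split /=; apply: eq_bigr => e eA.
rewrite (bigID (lt e)) /=; congr (_ + _)%N; apply: eq_bigl => d; rewrite !inE.
  by case: eqVneq => //= ->; rewrite /lt ltnn andbF.
rewrite -andbA andbCA; congr (_ && _); rewrite /lt -leqNgt ltn_neqAle; congr (~~ _ && _).
by rewrite val_eqE (inj_eq enum_rank_inj).
Qed.

(** Converts counts over 5-subsets into averages over triples. *)
Lemma bin5_bin3 n : ('C(n, 5) * 20 = 'C(n, 3) * ((n - 3) * (n - 4)))%N.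
Proof.
have h4 := mul_bin_left n 4; have h3 := mul_bin_left n 3.
nia.
Qed.

(** * Circumcircles and the lifting to the paraboloid *)

Section Circles.
Variable R : realType.
Local Notation plane := (R * R)%type.
Implicit Types x : plane.

Definition sqdist x (p : plane) : R := (x.1 - p.1) ^+ 2 + (x.2 - p.2) ^+ 2.

Lemma sqdist_ge0 x p : 0 <= sqdist x p.
Proof. by rewrite addr_ge0 ?sqr_ge0. Qed.

Lemma sqdist_gt0 x p : x != p -> 0 < sqdist x p.
Proof.
case: x p => [a b] [c d] h; rewrite lt_neqAle sqdist_ge0 andbT eq_sym.
apply: contraNneq h => /eqP; rewrite paddr_eq0 ?sqr_ge0 // !sqrf_eq0 !subr_eq0 /=.
by move=> /andP[/eqP -> /eqP ->].
Qed.

Variables (I : finType) (pt : I -> plane).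
Hypothesis pt_inj : injective pt.
Hypothesis no3collinear : forall T : {set I}, #|T| = 3%N -> forall a b c : R,
  (forall i, i \in T -> a * (pt i).1 + b * (pt i).2 = c) -> (a, b) = (0, 0).
Hypothesis no4cocircular : forall T : {set I}, #|T| = 4%N -> forall x (rho : R),
  ~ (forall i, i \in T -> sqdist x (pt i) = rho).

Lemma cards3P (T : {set I}) : #|T| = 3%N ->
  exists i j k, [/\ i != j, T = [set i; j; k]%SET & k \notin [set i; j]%SET].
Proof.
move=> T3; have /card_gt0P [k kT] : (0 < #|T|)%N by rewrite T3.
have : #|T :\ k| == 2%N by move: T3; rewrite (cardsD1 k) kT add1n => -[->].
case/cards2P => i [j [ij e]]; exists i, j, k; split => //.
  by rewrite -e finset.setUC finset.setD1K.
by rewrite -e !inE eqxx.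
Qed.

Lemma circumcenter_exists (T : {set I}) : #|T| = 3%N ->
  exists x : plane, exists rho : R, forall i, i \in T -> sqdist x (pt i) = rho.
Proof.
move=> T3; have [i [j [k [ij TE _]]]] := cards3P T3.
pose u : plane := ((pt j).1 - (pt i).1, (pt j).2 - (pt i).2).
pose v : plane := ((pt k).1 - (pt i).1, (pt k).2 - (pt i).2).
pose D := u.1 * v.2 - u.2 * v.1.
have D0 : D != 0.
  apply/eqP => D0.
  have : (- u.2, u.1) = (0, 0).
    apply: (no3collinear T3 (c := - u.2 * (pt i).1 + u.1 * (pt i).2)).
    move=> l; rewrite TE !inE => /orP[/orP[]|] /eqP ->; rewrite /u /=.
    - by [].
    - by ring.
    - by move: D0; rewrite /D /u /v /= => D0; lra.
  rewrite /u /= => -[/eqP + /eqP]; rewrite oppr_eq0 !subr_eq0 => /eqP h2 /eqP h1.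
  move/eqP: ij; apply; apply: pt_inj.
  by move: h1 h2; case: (pt i) (pt j) => [a b] [c d] /= -> ->.
(* Cramer's rule for 2 w.u = |u|^2 and 2 w.v = |v|^2, the equations of the circumcenter relative to
   the point i. *)
pose w : plane := ((v.2 * (u.1 ^+ 2 + u.2 ^+ 2) - u.2 * (v.1 ^+ 2 + v.2 ^+ 2)) / (2 * D),
                   (u.1 * (v.1 ^+ 2 + v.2 ^+ 2) - v.1 * (u.1 ^+ 2 + u.2 ^+ 2)) / (2 * D)).
exists ((pt i).1 + w.1, (pt i).2 + w.2), (w.1 ^+ 2 + w.2 ^+ 2).
have e1 : 2 * (w.1 * u.1 + w.2 * u.2) = u.1 ^+ 2 + u.2 ^+ 2.
  by move: D0; rewrite /w /D /u /v /= => D0; field.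
have e2 : 2 * (w.1 * v.1 + w.2 * v.2) = v.1 ^+ 2 + v.2 ^+ 2.
  by move: D0; rewrite /w /D /u /v /= => D0; field.
move=> l; rewrite TE !inE /sqdist => /orP[/orP[]|] /eqP -> /=.
- by ring.
- by move: e1; rewrite /u /=; move: (w.1) (w.2) => a b e1; lra.
- by move: e2; rewrite /v /=; move: (w.1) (w.2) => a b e2; lra.
Qed.

(** The default (0, 0) is never reached for a triple, by [circumcenter_exists]. *)
Definition ctr (T : {set I}) : plane :=
  xget (0, 0) [set x | exists rho, forall i, i \in T -> sqdist x (pt i) = rho].

Definition sqrad (T : {set I}) : R :=
  xget 0 [set rho | forall i, i \in T -> sqdist (ctr T) (pt i) = rho].

(** Its cardinality is the exponent x_T of the generating polynomial. *)
Definition inside (T : {set I}) : {set I} :=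
  [set d | sqdist (ctr T) (pt d) < sqrad T].

Lemma sqdist_ctr (T : {set I}) i : #|T| = 3%N -> i \in T -> sqdist (ctr T) (pt i) = sqrad T.
Proof.
move=> T3; have [x hx] := circumcenter_exists T3.
have [rho hr] := @xgetPex _ (0, 0) [set x | exists rho, forall i, i \in T -> sqdist x (pt i) = rho] (ex_intro _ x hx).
exact: (@xgetPex _ 0 [set rho | forall i, i \in T -> sqdist (ctr T) (pt i) = rho] (ex_intro _ rho hr)).
Qed.

Lemma insideF (T : {set I}) i : #|T| = 3%N -> i \in T -> (i \in inside T) = false.
Proof. by move=> T3 iT; rewrite inE sqdist_ctr // ltxx. Qed.

Lemma sqdist_ctr_neq (T : {set I}) d : #|T| = 3%N -> d \notin T ->
  sqdist (ctr T) (pt d) != sqrad T.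
Proof.
move=> T3 dT; apply/eqP => e; apply: (@no4cocircular (d |: T) _ (ctr T) (sqrad T)).
  by rewrite cardsU1 dT T3.
by move=> i /setU1P[->//|]; exact: sqdist_ctr.
Qed.

Definition affine_dependency (A : {set I}) (l : I -> R) : Prop :=
  [/\ exists2 i, i \in A & l i != 0, \sum_(i in A) l i = 0,
      \sum_(i in A) l i * (pt i).1 = 0 & \sum_(i in A) l i * (pt i).2 = 0].

(* The value of the dependency on the third coordinate of the points lifted to
   the paraboloid [z = x^2 + y^2]. *)
Definition lifted_sum (A : {set I}) (l : I -> R) : R :=
  \sum_(i in A) l i * ((pt i).1 ^+ 2 + (pt i).2 ^+ 2).

(** As a function of the point p, [sqdist x p - rho] is |p|^2 plus an affine function, which the
    dependency annihilates. Hence the circle can be chosen freely. *)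
Lemma dependency_sqdist A l x rho : affine_dependency A l ->
  \sum_(i in A) l i * (sqdist x (pt i) - rho) = lifted_sum A l.
Proof.
case=> _ s0 s1 s2.
have -> : lifted_sum A l = lifted_sum A l + (x.1 ^+ 2 + x.2 ^+ 2 - rho) * \sum_(i in A) l i
   - 2 * x.1 * \sum_(i in A) l i * (pt i).1 - 2 * x.2 * \sum_(i in A) l i * (pt i).2.
  by rewrite s0 s1 s2; ring.
rewrite /lifted_sum !mulr_sumr -big_split -!sumrB /=; apply: eq_bigr => i _.
by rewrite /sqdist; ring.
Qed.

Lemma affine_dependency_exists (A : {set I}) : (3 < #|A|)%N ->
  exists l, affine_dependency A l.
Proof.
pose phi i (j : 'I_3) : R := if val j == 0%N then 1 else if val j == 1%N then (pt i).1 else (pt i).2.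
case/(linear_dependency phi) => l l0 hl; exists l; split => //.
- by rewrite -[RHS](hl 0); apply: eq_bigr => i _; rewrite /phi mulr1.
- exact: (hl 1).
- exact: (hl 2).
Qed.

Lemma lifted_dependency_exists (A : {set I}) : (4 < #|A|)%N ->
  exists2 l, affine_dependency A l & lifted_sum A l = 0.
Proof.
pose phi i (j : 'I_4) : R := if val j == 0%N then 1 else if val j == 1%N then (pt i).1
  else if val j == 2%N then (pt i).2 else (pt i).1 ^+ 2 + (pt i).2 ^+ 2.
case/(linear_dependency phi) => l l0 hl; exists l; last exact: (hl 3).
split => //.
- by rewrite -[RHS](hl 0); apply: eq_bigr => i _; rewrite /phi mulr1.
- exact: (hl 1).
- exact: (hl 2).
Qed.

(** For the circle through the other three points only the term of d is left, while the value of the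
    sum does not depend on d. *)
Lemma dependency4 (Q : {set I}) l d : #|Q| = 4%N -> affine_dependency Q l -> d \in Q ->
  l d * (sqdist (ctr (Q :\ d)) (pt d) - sqrad (Q :\ d)) = lifted_sum Q l.
Proof.
move=> Q4 hl dQ; rewrite -(dependency_sqdist (ctr (Q :\ d)) (sqrad (Q :\ d)) hl) (bigD1 d) //=.
rewrite big1 ?addr0 // => i /andP[iQ id].
have T3 : #|Q :\ d| = 3%N by move: Q4; rewrite (cardsD1 d) dQ add1n => -[].
by rewrite sqdist_ctr ?subrr ?mulr0 // !inE id.
Qed.

(* All the products [l d * D] are nonzero and they sum to zero. *)
Lemma inside_count4 (Q : {set I}) : #|Q| = 4%N ->
  (1 <= \sum_(d in Q) (d \in inside (Q :\ d)) <= 3)%N.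
Proof.
move=> Q4; have [l hl] : exists l, affine_dependency Q l.
  by apply: affine_dependency_exists; rewrite Q4.
have [[i0 i0Q li0] s0 _ _] := hl.
set D := lifted_sum Q l.
have T3 d : d \in Q -> #|Q :\ d| = 3%N.
  by move=> dQ; move: Q4; rewrite (cardsD1 d) dQ add1n => -[].
have pow0 d : d \in Q -> sqdist (ctr (Q :\ d)) (pt d) - sqrad (Q :\ d) != 0.
  by move=> dQ; rewrite subr_eq0 sqdist_ctr_neq ?T3 // !inE eqxx.
have D0 : D != 0.
  by rewrite /D -(dependency4 Q4 hl i0Q) mulf_neq0 // pow0.
(* l d * D is (l d)^2 times the power of d with respect to the circle through the other three
   points. *)
have insE d : d \in Q -> (d \in inside (Q :\ d)) = (l d * D < 0).
  move=> dQ; rewrite inE -subr_lt0 /D -(dependency4 Q4 hl dQ) mulrA -expr2.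
  rewrite pmulr_rlt0 // exprn_even_gt0 //=.
  by apply: contraNneq D0 => l0; rewrite /D -(dependency4 Q4 hl dQ) l0 mul0r.
have lD0 d : d \in Q -> l d * D != 0.
  move=> dQ; rewrite mulf_neq0 //.
  by apply: contraNneq D0 => l0; rewrite /D -(dependency4 Q4 hl dQ) l0 mul0r.
have sD : \sum_(d in Q) l d * D = 0 by rewrite -mulr_suml s0 mul0r.
have [d1 d1Q hd1] : exists2 d, d \in Q & l d * D < 0.
  apply/exists_inP; apply: contraT => /exists_inPn h.
  have h' d : d \in Q -> 0 <= l d * D by move=> /h; rewrite -leNgt.
  by move/eqP: sD; rewrite psumr_eq0 // => /allP/(_ i0); rewrite mem_index_enum i0Q (negPf (lD0 _ i0Q)) => /(_ isT).
have [d2 d2Q hd2] : exists2 d, d \in Q & 0 < l d * D.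
  apply/exists_inP; apply: contraT => /exists_inPn h.
  have h' d : d \in Q -> 0 <= - (l d * D) by move=> /h; rewrite -leNgt oppr_ge0.
  move/eqP: sD; rewrite -oppr_eq0 -sumrN psumr_eq0 // => /allP/(_ i0).
  by rewrite mem_index_enum i0Q oppr_eq0 (negPf (lD0 _ i0Q)) => /(_ isT).
apply/andP; split.
  by rewrite (bigD1 d1) //= insE // hd1.
rewrite (bigD1 d2) //= insE // ltNge (ltW hd2) add0n.
apply: (@leq_trans (\sum_(d in Q | d != d2) 1)%N).
  by apply: leq_sum => d _; case: (_ \in _).
rewrite sum1_card -(T3 d2 d2Q); apply: subset_leq_card.
by apply/fintype.subsetP => d; rewrite !inE andbC.
Qed.

Lemma cardsD2 (F : {set I}) d e : e \in F -> d \in F :\ e -> #|F :\ e :\ d| = (#|F| - 2)%N.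
Proof. by move=> eF dF; rewrite [in RHS](cardsD1 e) eF (cardsD1 d (F :\ e)) dF !add1n subn2. Qed.

(** * Five points and the Radon partition of their lifts *)

Section FivePoints.
Variables (F : {set I}) (l : I -> R).
Hypotheses (F5 : #|F| = 5%N) (hl : affine_dependency F l) (hL : lifted_sum F l = 0).

Lemma dependency5 d e : e \in F -> d \in F :\ e ->
  let T := F :\ e :\ d in
  l e * (sqdist (ctr T) (pt e) - sqrad T) = - (l d * (sqdist (ctr T) (pt d) - sqrad T)).
Proof.
move=> eF dF T; apply/eqP; rewrite -addr_eq0; apply/eqP.
rewrite -[RHS]hL -(dependency_sqdist (ctr T) (sqrad T) hl) (bigD1 e) //= (bigD1 d) /=; last first.
  by move: dF; rewrite !inE andbC.
rewrite big1 ?addr0 // => i /andP[/andP[iF ie] id].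
by rewrite sqdist_ctr ?subrr ?mulr0 // /T ?cardsD2 ?F5 // !inE ie id.
Qed.

Lemma sqdist_ctr_neq5 d e : e \in F -> d \in F :\ e ->
  let T := F :\ e :\ d in
  sqdist (ctr T) (pt e) - sqrad T != 0 /\ sqdist (ctr T) (pt d) - sqrad T != 0.
Proof.
move=> eF dF T; have T3 : #|T| = 3%N by rewrite cardsD2 ?F5.
by split; rewrite subr_eq0 sqdist_ctr_neq // !inE eqxx ?andbF.
Qed.

(** By [dependency5] a vanishing coefficient would force every other one to vanish, since the powers
    are nonzero. *)
Lemma dependency5_neq0 i : i \in F -> l i != 0.
Proof.
have [[i0 i0F li0] _ _ _] := hl.
have [->//|ii0 iF] := eqVneq i i0.
have iF0 : i \in F :\ i0 by rewrite !inE ii0.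
have [p1 p2] := sqdist_ctr_neq5 i0F iF0.
apply: contraNneq (mulf_neq0 li0 p1) => l0.
by rewrite (dependency5 i0F iF0) l0 mul0r oppr0.
Qed.

(* A point whose coefficient is the only positive one would be a convex
   combination of the others, against the strict convexity of the paraboloid. *)
Lemma dependency5_pos : (1 < #|[set i in F | (0 < l i)%R]%SET|)%N.
Proof.
rewrite ltnNge; apply/negP => hA.
have [e eF he] : exists2 e, e \in F & forall i, i \in F -> i != e -> l i < 0.
  have [A0|/set0Pn [e]] := eqVneq [set i in F | (0 < l i)%R]%SET finset.set0.
    have [[i0 i0F _] _ _ _] := hl; exists i0 => // i iF _.
    have := finset.in_set0 i; rewrite -A0 inE iF /= => /negbT; rewrite -leNgt le_eqVlt.
    by rewrite (negPf (dependency5_neq0 iF)).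
  rewrite inE => /andP[eF le]; exists e => // i iF ie.
  rewrite lt_neqAle dependency5_neq0 //= leNgt; apply/negP => li.
  move: hA; rewrite leqNgt => /negP; apply; apply/card_gt1P.
  by exists i, e; split; rewrite // inE ?iF ?eF.
(* The circle of radius 0 at the point e kills its term and leaves a zero sum of nonpositive terms l
   i |p_i - p_e|^2. *)
have := dependency_sqdist (pt e) 0 hl; rewrite hL (bigD1 e) //=.
rewrite {1}/sqdist !subrr expr0n add0r subr0 mulr0 add0r => /eqP.
rewrite -oppr_eq0 -sumrN psumr_eq0; last first.
  move=> i /andP[iF ie]; rewrite subr0 -mulNr mulr_ge0 ?sqdist_ge0 // oppr_ge0 ltW //.
  exact: he.
have [j] : exists j, j \in F :\ e.
  by apply/set0Pn; rewrite -card_gt0; move: F5; rewrite (cardsD1 e) eF add1n => -[->].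
rewrite !inE => /andP[je jF] /allP/(_ j); rewrite mem_index_enum jF je /= => /(_ isT).
rewrite subr0 oppr_eq0 mulf_eq0 (negPf (dependency5_neq0 jF)) /=.
by rewrite gt_eqF // sqdist_gt0 // (inj_eq pt_inj) eq_sym.
Qed.

(** The circle separates d and e exactly when their powers q and p have opposite signs, and
    [dependency5] reads l e p = - l d q. *)
Lemma separated5 d e : e \in F -> d \in F :\ e ->
  let T := F :\ e :\ d in
  ((d \in inside T) != (e \in inside T)) = (0 < l d * l e).
Proof.
move=> eF dF T; have [pe pd] := sqdist_ctr_neq5 eF dF.
have : l e * (sqdist (ctr T) (pt e) - sqrad T) = - (l d * (sqdist (ctr T) (pt d) - sqrad T)).
  exact: dependency5.
rewrite !inE -/T -(subr_lt0 (sqrad T) (sqdist _ (pt d))) -(subr_lt0 (sqrad T) (sqdist _ (pt e))).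
move: pe pd; rewrite -/T.
move: (sqdist _ (pt e) - _) (sqdist _ (pt d) - _) => p q p0 q0 h.
have ld0 : l d != 0 by apply: dependency5_neq0; move: dF; rewrite inE => /andP[].
have neg : (l d * l e) * (q * p) < 0.
  have -> : (l d * l e) * (q * p) = - (l d * q) ^+ 2.
    by transitivity (l d * q * (l e * p)); [ring | rewrite h; ring].
  by rewrite oppr_lt0 exprn_even_gt0 //= mulf_neq0.
have [qp|qp] := ltP 0 (q * p).
  rewrite [RHS]ltNge ltW /=; last by rewrite -(pmulr_llt0 _ qp).
  by apply/negbTE; rewrite negbK; have [p1|p1] := ltP p 0; have [q1|q1] := ltP q 0 => //; nra.
have {}qp : q * p < 0 by rewrite lt_neqAle mulf_neq0.
rewrite -(nmulr_llt0 _ qp) neg.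
by have [p1|p1] := ltP p 0; have [q1|q1] := ltP q 0 => //; nra.
Qed.
End FivePoints.

Lemma affine_dependencyN A l : affine_dependency A l -> affine_dependency A (\- l).
Proof.
have N (g : I -> R) : \sum_(i in A) - l i * g i = - \sum_(i in A) l i * g i.
  by rewrite -sumrN; apply: eq_bigr => i _; rewrite mulNr.
case=> -[i iA li] s0 s1 s2; split.
- by exists i; rewrite // oppr_eq0.
- by rewrite sumrN s0 oppr0.
- by rewrite N s1 oppr0.
- by rewrite N s2 oppr0.
Qed.

(** A pair is separated by the circle through the other three points when its coefficients have
    equal signs. Signs split 2 + 3, which gives 1 + 3 = 4 such pairs, each counted in the one order
    with d inside and e outside. *)
Lemma inside_count5 (F : {set I}) : #|F| = 5%N ->
  (\sum_(e in F) \sum_(d in F :\ e)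
     ((d \in inside (F :\ e :\ d)) && (e \notin inside (F :\ e :\ d))) = 4)%N.
Proof.
move=> F5; have [|l hl hL] := @lifted_dependency_exists F; first by rewrite F5.
set u := LHS.
have uS : u = (\sum_(e in F) \sum_(d in F :\ e)
     ((e \in inside (F :\ e :\ d)) && (d \notin inside (F :\ e :\ d))))%N.
  rewrite /u (exchange_big_dep (mem F)) /=; last by move=> e d _; rewrite inE => /andP[].
  apply: eq_bigr => d dF; apply: eq_big => [e|e _].
    by rewrite !inE dF andbT eq_sym andbC.
  by rewrite !finset.setDDl [[set e] :|: _]finset.setUC.
(* Adding the sum with d and e exchanged counts ordered separated pairs: 2 * 1 + 3 * 2 = 8. *)
have : (u + u = 8)%N.
  rewrite {1}uS /u -big_split /=.
  pose A := [set i in F | (0 < l i)%R]%SET; pose B := [set i in F | (l i < 0)%R]%SET.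
  have hA : (1 < #|A|)%N by exact: dependency5_pos.
  have hB : (1 < #|B|)%N.
    have -> : B = [set i in F | (0 < (\- l) i)%R]%SET.
      by apply/finset.setP => i; rewrite !inE oppr_gt0.
    apply: dependency5_pos => //; first exact: affine_dependencyN.
    transitivity (- lifted_sum F l); last by rewrite hL oppr0.
    rewrite /lifted_sum -sumrN.
    by apply: eq_bigr => i _; rewrite mulNr.
  have AB i : i \in F -> (i \in B) = (i \notin A).
    move=> iF; rewrite !inE iF /= -leNgt le_eqVlt.
    by rewrite (negPf (dependency5_neq0 F5 hl hL iF)).
  have cAB : (#|A| + #|B| = 5)%N.
    rewrite -F5 -(cardsID A F); congr (_ + _)%N.
      by apply: eq_card => i; rewrite !inE; case: (i \in F).
    apply: eq_card => i; rewrite [RHS]inE; case iF: (i \in F).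
      by rewrite AB // andbT.
    by rewrite inE iF andbF.
  have inner e : e \in F -> (\sum_(d in F :\ e)
     ((e \in inside (F :\ e :\ d)) && (d \notin inside (F :\ e :\ d))) +
     \sum_(d in F :\ e)
     ((d \in inside (F :\ e :\ d)) && (e \notin inside (F :\ e :\ d))) =
     (if e \in A then #|A|.-1 else #|B|.-1))%N.
    move=> eF; rewrite -big_split /=.
    transitivity (\sum_(d in F :\ e | (0 < l d * l e)%R) 1)%N.
      rewrite [RHS]big_mkcondr; apply: eq_bigr => d dF.
      by rewrite -(separated5 F5 hl hL eF dF); do 2!case: (_ \in inside _).
    rewrite sum1_card; case: ifP => eA.
      have le : 0 < l e by move: eA; rewrite inE => /andP[].
      rewrite (cardsD1 e A) eA add1n /=; apply: eq_card => d.
      by rewrite !inE unfold_in /= !inE pmulr_lgt0 // andbA.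
    have eB : e \in B by rewrite AB // eA.
    have le : l e < 0 by move: eB; rewrite inE => /andP[].
    rewrite (cardsD1 e B) eB add1n /=; apply: eq_card => d.
    by rewrite !inE unfold_in /= !inE nmulr_lgt0 // andbA.
  rewrite (eq_bigr _ inner) (bigID (mem A)) /=.
  rewrite (eq_bigr (fun=> #|A|.-1)); last by move=> e /andP[_ ->].
  rewrite [X in (_ + X)%N](eq_bigr (fun=> #|B|.-1)); last by move=> e /andP[_ /negPf ->].
  have sA : [set e | (e \in F) && (e \in A)]%SET = A.
    by apply/finset.setP => e; rewrite !inE; case: (e \in F).
  have sB : [set e | (e \in F) && (e \notin A)]%SET = B.
    apply/finset.setP => e; rewrite [LHS]inE; have [eF|eF] := boolP (e \in F).
      by rewrite AB.
    by rewrite /= [RHS]inE (negPf eF).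
  rewrite !sum_nat_cond_const sA sB.
  have : (#|A| = 2 \/ #|A| = 3)%N by lia.
  have -> : #|B| = (5 - #|A|)%N by lia.
  by case=> ->.
lia.
Qed.

(** * Averages over all triples *)

Lemma inside_subset (T : {set I}) : #|T| = 3%N -> inside T \subset ~: T.
Proof.
move=> T3; apply/fintype.subsetP => d dT; rewrite inE; apply/negP => h.
by rewrite (insideF T3 h) in dT.
Qed.

Lemma card_setC3 (T : {set I}) : #|T| = 3%N -> #|~: T| = (#|I| - 3)%N.
Proof. by move=> T3; rewrite cardsCs finset.setCK T3. Qed.

Lemma inside_card_le (T : {set I}) : #|T| = 3%N -> (#|inside T| <= #|I| - 3)%N.
Proof.
by move=> T3; rewrite -(card_setC3 T3); exact: subset_leq_card (inside_subset T3).
Qed.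

Lemma sum_inside_outside :
  (\sum_(T : {set I} | #|T| == 3) #|inside T| * (#|I| - 3 - #|inside T|) = 'C(#|I|, 5) * 4)%N.
Proof.
transitivity (\sum_(T : {set I} | #|T| == 3) \sum_(d | d \notin T) \sum_(e | e \notin d |: T)
   ((d \in inside T) && (e \notin inside T)))%N.
  apply: eq_bigr => T /eqP T3.
  rewrite [RHS](bigID (mem (inside T))) /= [X in (_ + X)%N]big1 ?addn0; last first.
    by move=> d /andP[_ /negPf ->]; rewrite big1.
  have dI d : (d \notin T) && (d \in inside T) = (d \in inside T).
    by case dT : (d \in T); rewrite // insideF.
  rewrite (eq_bigl (mem (inside T))) //.
  rewrite (eq_bigr (fun=> (#|I| - 3 - #|inside T|)%N)) ?sum_nat_const //.
  move=> d dT; rewrite (eq_bigr (fun e => (e \notin inside T) : nat)); last first.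
    by move=> e _; rewrite (dT : d \in inside T).
  rewrite -big_mkcondr /= sum1_card.
  rewrite -(card_setC3 T3) -(cardsID (inside T)) (finset.setIidPr (inside_subset T3)) addKn.
  apply: eq_card => e.
  rewrite unfold_in /= finset.in_setU1 negb_or finset.in_setD finset.in_setC -andbA [RHS]andbC.
  by case: eqVneq => //= ->; rewrite (dT : d \in inside T) andbF.
transitivity (\sum_(F : {set I} | #|F| == 5) \sum_(e in F) \sum_(d in F :\ e)
     ((d \in inside (F :\ e :\ d)) && (e \notin inside (F :\ e :\ d))))%N.
  exact: (exchange_sum_add2 _ (fun T d e => ((d \in inside T) && (e \notin inside T) : nat))).
rewrite (eq_bigr (fun=> 4%N)); last by move=> F /eqP; exact: inside_count5.
by rewrite sum_nat_cond_const card_draws.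
Qed.

Lemma sum_inside_bounds :
  ('C(#|I|, 5) * 6 <= (\sum_(T : {set I} | #|T| == 3) #|inside T|) * (#|I| - 4) <= 'C(#|I|, 5) * 14)%N.
Proof.
have -> : ((\sum_(T : {set I} | #|T| == 3) #|inside T|) * (#|I| - 4) =
  \sum_(F : {set I} | #|F| == 5) \sum_(e in F) \sum_(d in F :\ e) (d \in inside (F :\ e :\ d)))%N.
  transitivity (\sum_(T : {set I} | #|T| == 3) \sum_(d | d \notin T) \sum_(e | e \notin d |: T) (d \in inside T))%N;
    last by exact: (exchange_sum_add2 _ (fun T d e => (d \in inside T : nat))).
  rewrite big_distrl /=.
  apply: eq_bigr => T /eqP T3.
  rewrite (eq_bigr (fun d => (d \in inside T) * (#|I| - 4))%N); last first.
    move=> d dT; rewrite (sum_nat_cond_const (fun e => e \notin d |: T)) mulnC; congr (_ * _)%N.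
    have -> : [set e | e \notin d |: T]%SET = ~: (d |: T).
      by apply/finset.setP => e; rewrite !inE.
    by rewrite cardsCs finset.setCK cardsU1 dT T3.
  rewrite -big_distrl /=; congr (_ * _)%N.
  rewrite -big_mkcondr /= sum1_card; apply: eq_card => d.
  rewrite [RHS]unfold_in; case dT : (d \in T) => /=; last by [].
  by rewrite insideF.
have bnd (F : {set I}) : #|F| == 5%N ->
   (6 <= \sum_(e in F) \sum_(d in F :\ e) (d \in inside (F :\ e :\ d)) <= 14)%N.
  move=> /eqP F5; set s := (X in (_ <= X <= _)%N).
  have [s5 s15] : (5 <= s)%N /\ (s <= 15)%N.
    have F4 e : e \in F -> #|F :\ e| = 4%N.
      by move=> eF; move: F5; rewrite (cardsD1 e) eF add1n => -[].
    split.
      rewrite -F5 -sum1_card; apply: leq_sum => e eF.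
      by have /andP[] := inside_count4 (F4 e eF).
    have -> : 15%N = (\sum_(e in F) 3)%N by rewrite sum_nat_const F5.
    by apply: leq_sum => e eF; have /andP[] := inside_count4 (F4 e eF).
  (* Splitting on whether e is inside too: the case with e outside contributes 4 by [inside_count5],
     and the case with both inside is symmetric, hence even. *)
  have [|w hw] := @even_sum_sym _ F (fun e d => (d \in inside (F :\ e :\ d)) && (e \in inside (F :\ e :\ d))).
    by move=> e d; rewrite !finset.setDDl finset.setUC andbC.
  have : s = (4 + w.*2)%N.
    rewrite -(inside_count5 F5) -hw -big_split /=; apply: eq_bigr => e _.
    rewrite -big_split /=; apply: eq_bigr => d _.
    by do 2!case: (_ \in inside _).
  by move=> sE; move: s5 s15; rewrite sE -muln2; lia.
have cF : #|[set F : {set I} | #|F| == 5%N]%SET| = 'C(#|I|, 5) by rewrite card_draws.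
rewrite -!cF -!(sum_nat_cond_const (fun F : {set I} => #|F| == 5%N)).
by apply/andP; split; apply: leq_sum => F /bnd /andP[].
Qed.

(** With mean mu the right-hand side is mu (N - mu) - N (N - 1) / 5 - mu. It is concave in mu, and
    on [0.3 N, 0.7 N] its minimum, at mu = 0.7 N, is N^2 / 100 - N / 2. *)
Lemma inside_spread (s : seq nat) (N : nat) : (#|I| = N.+3)%N -> (3 <= N)%N ->
  s = [seq #|inside T| | T <- enum [pred T : {set I} | #|T| == 3%N]] ->
  [/\ (size s)%:R > 0 :> R, {in s, forall c, (c <= N)%N} &
  (N%:R / 10) ^+ 2 - N%:R / 2 <=
    (\sum_(c <- s) (c * c.-1)%:R) / (size s)%:R - ((\sum_(c <- s) c%:R) / (size s)%:R) ^+ 2 :> R].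
Proof.
move=> IN N3 sE.
have e3 : (#|I| - 3 = N)%N by lia.
have e4 : (#|I| - 4 = N.-1)%N by lia.
have sz : size s = 'C(#|I|, 3).
  by rewrite sE size_map -cardE -card_draws; apply: eq_card => T; rewrite !inE.
have bigE (F : nat -> nat) : (\sum_(c <- s) F c = \sum_(T : {set I} | #|T| == 3) F #|inside T|)%N.
  by rewrite sE big_map big_enum.
have hs : {in s, forall c, (c <= N)%N}.
  move=> c; rewrite sE => /mapP [T + ->]; rewrite mem_enum inE => /eqP T3.
  by have := inside_card_le T3; rewrite e3.
have m0 : (0 < size s)%N by rewrite sz bin_gt0 IN.
have B := bin5_bin3 #|I|.
have A1 := sum_inside_outside.
have /andP[A2 A3] := sum_inside_bounds.
rewrite e3 in A1; rewrite e4 in A2 A3; rewrite e3 e4 -sz in B.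
rewrite -(bigE (fun c => c * (N - c))%N) in A1.
rewrite -(bigE id) in A2 A3.
set m := size s in m0 B *.
set S1 := (\sum_(c <- s) c)%N in A2 A3.
pose S2 := (\sum_(c <- s) c * c.-1)%N.
have S12 : (\sum_(c <- s) c * (N - c) + S2 + S1 = N * S1)%N.
  rewrite /S1 /S2 big_distrr -!big_split /= !big_seq; apply: eq_bigr => c /hs xN.
  by case: c xN => [|c] xN /=; nia.
split => //; first by rewrite ltr0n.
rewrite -!natr_sum -/S1 -/S2.
have mR : 0 < m%:R :> R by rewrite ltr0n.
set C5 := 'C(#|I|, 5) in A1 A2 A3 B.
have N1 : N.-1%:R = N%:R - 1 :> R by rewrite -subn1 natrB //; lia.
have BR : C5%:R * 20 = m%:R * (N%:R * (N%:R - 1)) :> R.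
  by rewrite -N1 -!natrM B.
have S12R : C5%:R * 4 + S2%:R + S1%:R = N%:R * S1%:R :> R.
  by rewrite -natrM -!natrD -natrM -S12 A1.
have A2R : C5%:R * 6 <= S1%:R * (N%:R - 1) :> R by rewrite -N1 -!natrM ler_nat.
have A3R : S1%:R * (N%:R - 1) <= C5%:R * 14 :> R by rewrite -N1 -!natrM ler_nat.
have NR : 3 <= N%:R :> R by rewrite ler_nat.
set mu := S1%:R / m%:R.
have S1E : S1%:R = mu * m%:R by rewrite /mu divfK ?gt_eqF.
clearbody mu; rewrite S1E in S12R A2R A3R.
have S2E : S2%:R / m%:R = (N%:R - 1) * mu - N%:R * (N%:R - 1) / 5.
  apply: (mulIf (_ : m%:R != 0)); first by rewrite gt_eqF.
  by rewrite divfK ?gt_eqF //; lra.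
rewrite S2E.
have lo : N%:R * 3 / 10 <= mu.
  have : (N%:R * 3 / 10 - mu) * (m%:R * (N%:R - 1)) <= 0 by lra.
  by rewrite pmulr_lle0 ?subr_le0 // mulr_gt0 // subr_gt0; lra.
have hi : mu <= N%:R * 7 / 10.
  have : (mu - N%:R * 7 / 10) * (m%:R * (N%:R - 1)) <= 0 by lra.
  by rewrite pmulr_lle0 ?subr_le0 // mulr_gt0 // subr_gt0; lra.
nra.
Qed.

(** * Voronoi cells and vertices at circumcenters *)

Definition cell (T : {set I}) : set plane :=
  [set x | forall p q, p \in T -> q \notin T -> sqdist x (pt p) < sqdist x (pt q)].

Definition dot x (p : plane) : R := x.1 * p.1 + x.2 * p.2.

Lemma dotN x p : dot (- x.1, - x.2) p = - dot x p.
Proof. by rewrite /dot /=; ring. Qed.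

Lemma closure_cell_le (T : {set I}) x (p q : I) : closure (cell T) x -> p \in T -> q \notin T ->
  sqdist x (pt p) <= sqdist x (pt q).
Proof.
move=> hx pT qT; rewrite leNgt; apply/negP => hlt.
pose f y := sqdist y (pt p) - sqdist y (pt q).
have cf : f y @[y --> x] --> f x.
  have c1 : (y.1 : R) @[y --> x] --> x.1 by exact: cvg_fst.
  have c2 : (y.2 : R) @[y --> x] --> x.2 by exact: cvg_snd.
  have c (r s : R) (g : plane -> R) : g y @[y --> x] --> r -> (g y - s) ^+ 2 @[y --> x] --> (r - s) ^+ 2.
    by move=> h; rewrite expr2; apply: cvgM; apply: cvgB => //; exact: cvg_cst.
  by apply: cvgB; apply: cvgD; exact: c.
have fx : 0 < f x by rewrite subr_gt0.
have [y [hy fy]] := hx _ (cvgr_gt _ cf _ fx).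
have := hy p q pT qT; rewrite ltNge => /negP; apply.
by move: fy; rewrite /= subr_gt0 => /ltW.
Qed.

(** The points x + e u with small e > 0 lie in the cell: strict inequalities persist, and ties are
    broken in favour of [T] by the direction u. *)
Lemma closure_cell_perturb (T : {set I}) x u :
  (forall p q, p \in T -> q \notin T -> sqdist x (pt p) <= sqdist x (pt q)) ->
  (forall p q, p \in T -> q \notin T -> sqdist x (pt p) = sqdist x (pt q) ->
     dot u (pt q) < dot u (pt p)) ->
  closure (cell T) x.
Proof.
move=> hle heq B hB.
pose g (e : R) : plane := (x.1 + e * u.1, x.2 + e * u.2).
have gx : g e @[e --> (0 : R)^'+] --> x.
  have c (a b : R) : a + e * b @[e --> (0 : R)^'+] --> a.
    rewrite -[X in _ --> X]addr0 -[X in _ --> _ + X](mul0r b).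
    apply: cvgD; first exact: cvg_cst.
    apply: cvgM; last exact: cvg_cst.
    exact: (@cvg_at_right_filter R R^o id 0 0 (@cvg_id _ _)).
  exact: (cvg_pair (c x.1 u.1) (c x.2 u.2)).
have hg : \forall e \near (0 : R)^'+, B (g e) by exact: gx.
have hc : \forall e \near (0 : R)^'+, forall pq : I * I, pq.1 \in T -> pq.2 \notin T ->
    sqdist (g e) (pt pq.1) < sqdist (g e) (pt pq.2).
  apply: filter_forall => -[p q] /=.
  have [pT|pT] := boolP (p \in T); last by apply: nearW.
  have [qT|qT] := boolP (q \in T); first by apply: nearW.
  have dE e : sqdist (g e) (pt p) - sqdist (g e) (pt q) =
     (sqdist x (pt p) - sqdist x (pt q)) - 2 * e * (dot u (pt p) - dot u (pt q)).
    by rewrite /sqdist /dot /g /=; ring.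
  have [h|h] := eqVneq (sqdist x (pt p)) (sqdist x (pt q)).
    have := heq p q pT qT h => hd.
    near=> e => _ _; rewrite -subr_lt0 dE h subrr sub0r oppr_lt0.
    by rewrite !mulr_gt0 // subr_gt0.
  have hlt : sqdist x (pt p) - sqdist x (pt q) < 0 by rewrite subr_lt0 lt_neqAle h hle.
  set b := dot u (pt p) - dot u (pt q) in dE.
  (* Below [e0] the shift 2 e |b| stays under the gap at x; adding 1 keeps the denominator positive
     when b = 0. *)
  pose e0 := - (sqdist x (pt p) - sqdist x (pt q)) / (2 * (`|b| + 1)).
  have e00 : 0 < e0 by rewrite divr_gt0 ?oppr_gt0 // mulr_gt0 // ltr_wpDl.
  near=> e => _ _; rewrite -subr_lt0 dE.
  have ep : 0 < e by [].
  have : e < e0 by near: e; exact: nbhs_right_lt.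
  rewrite /e0 ltr_pdivlMr ?mulr_gt0 ?ltr_wpDl // => he.
  have : - `|b| <= b by rewrite lerNl -normrN ler_norm.
  nra.
have hgc : \forall e \near (0 : R)^'+, B (g e) /\ forall pq : I * I, pq.1 \in T ->
    pq.2 \notin T -> sqdist (g e) (pt pq.1) < sqdist (g e) (pt pq.2).
  exact: filterI.
have [e [h1 h2]] := @filter_ex _ _ (at_right_proper_filter (0 : R)) _ hgc.
by exists (g e); split => // p q pT qT; exact: (h2 (p, q)).
Unshelve. all: by end_near.
Qed.

(** A normal to the line through the other two points b and c takes equal values on them and, by
    non-collinearity, another value at a; its sign is chosen accordingly. *)
Lemma separating_direction (T : {set I}) a : #|T| = 3%N -> a \in T ->
  exists u, forall q, q \in T -> q != a -> dot u (pt q) < dot u (pt a).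
Proof.
move=> T3 aT.
have /eqP/cards2P [b [c [bc TE]]] : #|T :\ a| = 2%N.
  by move: T3; rewrite (cardsD1 a) aT add1n => -[].
have inT q : q \in T -> [\/ q = a, q = b | q = c].
  move=> qT; have [->|qa] := eqVneq q a; first by constructor.
  have : q \in T :\ a by rewrite !inE qa.
  by rewrite TE !inE => /orP[/eqP ->|/eqP ->]; [constructor 2 | constructor 3].
pose n : plane := (- ((pt b).2 - (pt c).2), (pt b).1 - (pt c).1).
have nbc : dot n (pt b) = dot n (pt c) by rewrite /dot /n /=; ring.
have nab : dot n (pt a) != dot n (pt b).
  apply/eqP => e.
  have : (n.1, n.2) = (0, 0).
    apply: (no3collinear T3 (c := dot n (pt b))) => i iT.
    change (dot n (pt i) = dot n (pt b)).
    by case: (inT i iT) => ->; rewrite ?e // nbc.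
  rewrite /n /= => -[/eqP + /eqP]; rewrite oppr_eq0 !subr_eq0 => /eqP h2 /eqP h1.
  move/eqP: bc; apply; apply: pt_inj.
  by move: h1 h2; case: (pt b) (pt c) => [? ?] [? ?] /= -> ->.
have [h|h|h] := ltrgtP (dot n (pt a)) (dot n (pt b)); last by rewrite h eqxx in nab.
  exists (- n.1, - n.2) => q /inT hq qa; rewrite !dotN ltrN2.
  by case: hq qa => ->; rewrite ?eqxx -?nbc.
by exists n => q /inT; case=> ->; rewrite ?eqxx -?nbc.
Qed.

(** Subtracting the two circle equations gives a linear equation satisfied by three non-collinear
    points, so its coefficients vanish. *)
Lemma ctr_uniq (T : {set I}) x rho : #|T| = 3%N ->
  (forall i, i \in T -> sqdist x (pt i) = rho) -> ctr T = x /\ sqrad T = rho.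
Proof.
move=> T3 h.
have e : (2 * ((ctr T).1 - x.1), 2 * ((ctr T).2 - x.2)) = (0, 0).
  apply: (no3collinear T3 (c := (ctr T).1 ^+ 2 + (ctr T).2 ^+ 2 - x.1 ^+ 2 - x.2 ^+ 2 + rho - sqrad T)).
  move=> i iT; have := h i iT; have := sqdist_ctr T3 iT; rewrite /sqdist => h1 h2.
  lra.
have cx : ctr T = x.
  case: e; move: (ctr T) (x) => [a b] [c d] /= e1 e2; congr (_, _); lra.
split => //; have [i [j [k [_ TE _]]]] := cards3P T3.
have iT : i \in T by rewrite TE !inE eqxx.
by rewrite -(sqdist_ctr T3 iT) cx h.
Qed.

Definition near_sets (k : nat) x : {set {set I}} :=
  [set T : {set I} | (#|T| == k) && `[< closure (cell T) x >]]%SET.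

(** The three cells correspond to the enclosed points together with one point of [T], or with all
    but one; a separating direction or its opposite breaks the ties. *)
Lemma near_sets_ctr (T : {set I}) k : #|T| = 3%N ->
  (k == #|inside T|.+1) || (k == #|inside T|.+2) -> (3 <= #|near_sets k (ctr T)|)%N.
Proof.
move=> T3 hk.
have inr i : i \in inside T -> sqdist (ctr T) (pt i) < sqrad T by rewrite inE.
have ninr i : i \notin inside T -> sqrad T <= sqdist (ctr T) (pt i) by rewrite inE -leNgt.
have nT i : sqdist (ctr T) (pt i) = sqrad T -> i \in T.
  by move=> e; apply: contraT => /(sqdist_ctr_neq T3); rewrite e eqxx.
have disj i : i \in T -> i \notin inside T by move=> iT; rewrite insideF.
case/orP: hk => /eqP ->.
  pose f a := a |: inside T.
  have f_inj : {in T &, injective f}.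
    move=> a b aT bT /finset.setP/(_ a); rewrite /f finset.in_setU1 eqxx finset.in_setU1 insideF // orbF.
    by rewrite orbF => /esym/eqP.
  rewrite -T3 -(card_in_imset f_inj); apply: subset_leq_card.
  apply/fintype.subsetP => U /imsetP [a aT ->].
  rewrite [_ \in near_sets _ _]inE cardsU1 insideF // add1n eqxx /=; apply/asboolP.
  have [u hu] := separating_direction T3 aT.
  apply: (closure_cell_perturb (u := u)) => p q; rewrite !finset.in_setU1 negb_or => /orP[/eqP->|pi] /andP[qa qi].
  - by rewrite sqdist_ctr // ninr.
  - by apply: le_trans (ninr _ qi); apply/ltW/inr.
  - by rewrite sqdist_ctr // => /esym/nT qT; exact: hu.
  - by move=> e; move: (inr _ pi); rewrite e ltNge ninr.
pose f a := (T :\ a) :|: inside T.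
have f_inj : {in T &, injective f}.
  move=> a b aT bT /finset.setP/(_ a).
  rewrite /f !finset.in_setU !finset.in_setD1 eqxx aT insideF //= !orbF andbT => /esym/negbFE.
  by move/eqP.
rewrite -T3 -(card_in_imset f_inj); apply: subset_leq_card.
apply/fintype.subsetP => U /imsetP [a aT ->].
rewrite [_ \in near_sets _ _]inE; apply/andP; split.
  have d0 : (T :\ a) :&: inside T = finset.set0.
    apply/finset.setP => i; rewrite finset.in_setI finset.in_setD1 finset.in_set0.
    by case iT : (i \in T); rewrite ?andbF // insideF // andbF.
  rewrite cardsU d0 cards0 subn0.
  have -> : #|T :\ a| = 2%N by move: T3; rewrite (cardsD1 a) aT add1n => -[].
  by [].
apply/asboolP.
have [u hu] := separating_direction T3 aT.
apply: (closure_cell_perturb (u := (- u.1, - u.2))) => p q.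
  rewrite !finset.in_setU !finset.in_setD1 negb_or => hp /andP[_ qi].
  apply: le_trans (ninr _ qi).
  by case/orP: hp => [/andP[_ pT]|/inr/ltW//]; rewrite sqdist_ctr.
rewrite !finset.in_setU !finset.in_setD1 negb_or negb_and negbK => /orP[/andP[pa pT]|pi] /andP[qa qi].
  rewrite sqdist_ctr // => /esym/nT qT; rewrite qT orbF in qa.
  by rewrite !dotN ltrN2 (eqP qa); exact: hu.
by move=> e; move: (inr _ pi); rewrite e ltNge ninr.
Qed.

(** Every near set consists of all points [J] closer than the k-th distance rho and of k - |J|
    points of the circle [L] of radius rho. At most three points lie on [L], and three choices are
    needed. *)
Lemma near_sets_inv k x : (0 < k)%N -> (3 <= #|near_sets k x|)%N ->
  exists T : {set I}, [/\ #|T| = 3%N, ctr T = x &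
    (k == #|inside T|.+1) || (k == #|inside T|.+2)].
Proof.
move=> k0 h3.
have near_le T p q : T \in near_sets k x -> p \in T -> q \notin T ->
    sqdist x (pt p) <= sqdist x (pt q).
  by rewrite inE => /andP[_ /asboolP]; exact: closure_cell_le.
have near_card T : T \in near_sets k x -> #|T| = k by rewrite inE => /andP[/eqP].
have /card_gt0P [T1 hT1] : (0 < #|near_sets k x|)%N by apply: leq_trans h3.
have /card_gt0P [m0 m0T] : (0 < #|T1|)%N by rewrite near_card.
have [m mT hm] : exists2 m, m \in T1 & forall p, p \in T1 -> sqdist x (pt p) <= sqdist x (pt m).
  by case: (Order.TotalTheory.arg_maxP (fun p => sqdist x (pt p)) m0T) => m mT hm; exists m.
set rho := sqdist x (pt m) in hm.
pose J := [set p | sqdist x (pt p) < rho]%SET.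
pose L := [set p | sqdist x (pt p) == rho]%SET.
have JT1 : J \subset T1 :\ m.
  apply/fintype.subsetP => p; rewrite !inE => pr.
  apply/andP; split; first by apply: contraTneq pr => ->; rewrite ltxx.
  by apply: contraTT pr => pT; rewrite -leNgt; exact: near_le hT1 mT pT.
(* A point of [J] missing from T would put all of T within [J], which has fewer than k points. *)
have JT T : T \in near_sets k x -> J \subset T.
  move=> hT; apply/fintype.subsetP => p pJ; apply: contraT => pT.
  have : (#|T| <= #|T1 :\ m|)%N.
    apply: leq_trans (subset_leq_card JT1); apply: subset_leq_card.
    apply/fintype.subsetP => q qT; rewrite inE.
    by apply: le_lt_trans (near_le _ _ _ hT qT pT) _; rewrite inE in pJ.
  by move: (near_card _ hT1); rewrite (near_card _ hT) (cardsD1 m T1) mT; lia.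
have TJL T : T \in near_sets k x -> T :\: J \subset L.
  move=> hT; apply/fintype.subsetP => p; rewrite !inE -leNgt => /andP[rp pT].
  rewrite eq_le rp andbT leNgt; apply/negP => pr.
  have pT1 : p \notin T1 by apply/negP => /hm; rewrite leNgt pr.
  have /subsetPn [q qT1 qT] : ~~ (T1 \subset T).
    apply/negP => sT; have /eqP TE : T1 == T by rewrite eqEcard sT (near_card _ hT) (near_card _ hT1) leqnn.
    by rewrite TE pT in pT1.
  by have := near_le _ _ _ hT pT qT; rewrite leNgt (le_lt_trans (hm _ qT1) pr).
have L3 : (#|L| <= 3)%N.
  rewrite leqNgt; apply/negP => /card_geqP [s [us ss sL]].
  have s4 : #|[set i in s]%SET| = 4%N by rewrite cardsE (card_uniqP us).
  apply: (no4cocircular s4 (x := x) (rho := rho)) => i.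
  by rewrite inE => /sL; rewrite inE => /eqP.
pose f T := T :\: J.
have f_inj : {in near_sets k x &, injective f}.
  move=> T T' hT hT' e.
  rewrite -(finset.setID T J) -(finset.setID T' J) -/(f T) e.
  by rewrite (finset.setIidPr (JT _ hT)) (finset.setIidPr (JT _ hT')).
have fcard T : T \in near_sets k x -> #|f T| = (k - #|J|)%N.
  by move=> hT; rewrite cardsD (finset.setIidPr (JT _ hT)) near_card.
have hbin : (3 <= 'C(#|L|, k - #|J|))%N.
  apply: leq_trans h3 _; rewrite -(card_in_imset f_inj) -cards_draws.
  apply: subset_leq_card; apply/fintype.subsetP => U /imsetP [T hT ->].
  by rewrite inE TJL //= fcard.
have [LE kJ] : #|L| = 3%N /\ (k - #|J| = 1 \/ k - #|J| = 2)%N.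
  (* Among the binomials C(l, j) with l <= 3, only C(3, 1) and C(3, 2) reach 3. *)
  move: L3 hbin; case: #|L| => [|[|[|[|l]]]] // _; case: (k - #|J|)%N => [|[|[|[|j]]]] //=; try by auto.
have [cL rL] : ctr L = x /\ sqrad L = rho.
  by apply: ctr_uniq => // i; rewrite inE => /eqP.
have iL : inside L = J by apply/finset.setP => i; rewrite !inE cL rL.
exists L; split => //; rewrite iL; apply/orP.
by case: kJ => e; [left | right]; apply/eqP; lia.
Qed.

Definition vertex_triples (k : nat) : {set {set I}} :=
  [set T : {set I} | (#|T| == 3) && ((k == #|inside T|.+1) || (k == #|inside T|.+2))]%SET.

(* So concentric circumcircles contribute vertices of different orders. *)
Lemma concentric_card (T T' : {set I}) : #|T| = 3%N -> #|T'| = 3%N -> ctr T = ctr T' ->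
  sqrad T < sqrad T' -> (#|inside T| + 3 <= #|inside T'|)%N.
Proof.
move=> T3 T3' e lt_r.
have d0 : inside T :&: T = finset.set0.
  apply/finset.setP => i; rewrite finset.in_setI finset.in_set0.
  by case iT : (i \in T); rewrite ?andbF // insideF.
rewrite -T3 -cardsUI d0 cards0 addn0; apply: subset_leq_card.
apply/fintype.subsetP => i; rewrite finset.in_setU [i \in inside T']inE -e => /orP[|iT].
  by rewrite inE => /lt_trans; apply.
by rewrite sqdist_ctr.
Qed.

(** Concentric circles of different radii have enclosed counts at least 3 apart, whereas a common
    order k allows a difference of at most 1. With equal radii, a further point would give four
    cocircular points. *)
Lemma ctr_inj k : {in vertex_triples k &, injective ctr}.
Proof.
have main (T T' : {set I}) : #|T| = 3%N -> #|T'| = 3%N -> ctr T = ctr T' -> sqrad T = sqrad T' -> T' \subset T.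
  move=> T3 T3' ec er; apply/fintype.subsetP => d dT'; apply: contraT => dT.
  by have := sqdist_ctr_neq T3 dT; rewrite ec er sqdist_ctr // eqxx.
move=> T T'; rewrite !inE => /andP[/eqP T3 h] /andP[/eqP T3' h'] e.
have [lt_r|lt_r|er] := ltrgtP (sqrad T) (sqrad T').
- by have := concentric_card T3 T3' e lt_r; lia.
- by have := concentric_card T3' T3 (esym e) lt_r; lia.
by apply/eqP; rewrite eqEcard T3 T3' (main T' T).
Qed.

Lemma card_vertices k : (0 < k)%N ->
  #|` fset_set [set x | (3 <= #|near_sets k x|)%N]| = #|vertex_triples k|.
Proof.
move=> k0.
have -> : [set x | (3 <= #|near_sets k x|)%N] = [set` [fset ctr T | T in vertex_triples k]%fset].
  apply/seteqP; split => x /=.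
    move=> /(near_sets_inv k0) [T [T3 <- hT]]; apply/imfsetP; exists T => //=.
    by rewrite inE T3 hT.
  by move=> /imfsetP [T /=]; rewrite inE => /andP[/eqP T3 hk] ->; exact: near_sets_ctr.
by rewrite set_fsetK card_in_imfset ?cardE //=; exact: ctr_inj.
Qed.

(** A triple enclosing x points yields vertices of orders x + 1 and x + 2, hence the term z^x + z^(x
    + 1). *)
Lemma vertices_generating (F : comNzRingType) :
  \sum_(1 <= k < #|I|) (#|` fset_set [set x | (3 <= #|near_sets k x|)%N]|)%:R *: 'X^(k.-1)
  = (1 + 'X) * \sum_(T : {set I} | #|T| == 3%N) 'X^#|inside T| :> {poly F}.
Proof.
transitivity (\sum_(1 <= k < #|I|) \sum_(T : {set I} | #|T| == 3%N)
   ((k == #|inside T|.+1) + (k == #|inside T|.+2))%:R *: 'X^(k.-1) : {poly F}).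
  rewrite !big_nat; apply: eq_bigr => k /andP[k1 _].
  rewrite card_vertices // -scaler_suml -natr_sum; congr (_%:R *: _).
  rewrite -sum1_card (eq_bigl (fun T : {set I} => (#|T| == 3%N) && ((k == #|inside T|.+1) || (k == #|inside T|.+2)))).
    rewrite big_mkcondr; apply: eq_bigr => T _.
    by case: eqVneq => [->|_] /=; rewrite ?add0n; [rewrite eqn_leq ltnn andbF | case: eqP].
  by move=> T; rewrite inE.
rewrite exchange_big mulr_sumr; apply: eq_bigr => T /eqP T3.
(* This places both orders x + 1 and x + 2 in the range of summation. *)
have hx : (#|inside T| + 3 <= #|I|)%N.
  have := inside_card_le T3.
  have : (3 <= #|I|)%N by rewrite -T3; exact: max_card.
  lia.
rewrite mulrDl mul1r -exprS.
have pick (j : nat) : (j.+1 < #|I|)%N ->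
  \sum_(1 <= k < #|I|) (k == j.+1)%:R *: 'X^(k.-1) = 'X^j :> {poly F}.
  move=> hj; rewrite (big_cat_nat (n := j.+1)) //=; last by apply: ltnW.
  rewrite big_nat big1 ?add0r; last by move=> k /andP[_ kj]; rewrite ltn_eqF // scale0r.
  rewrite big_ltn // eqxx scale1r big_nat big1 ?addr0 // => k /andP[kj _].
  by rewrite gtn_eqF // scale0r.
under eq_bigr do rewrite natrD scalerDl.
by rewrite big_split /= !pick //; lia.
Qed.
End Circles.

(** * Voronoi polynomials *)

Section FsetPoints.
Variables (R : realType) (S : {fset R * R}).
Hypothesis gpS : general_position S.

Let pt (i : S) : R * R := val i.
Let imS (T : {set S}) : {fset R * R} := [fset pt i | i in T]%fset.

Lemma imS_sub (T : {set S}) : (imS T `<=` S)%fset.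
Proof. by apply/fsubsetP => p /imfsetP [i _ ->]; exact: valP. Qed.

Lemma card_imS (T : {set S}) : #|` imS T| = #|T|.
Proof. by rewrite card_imfset ?cardE //; exact: val_inj. Qed.

Lemma pt_no3collinear (T : {set S}) : #|T| = 3%N -> forall a b c : R,
  (forall i, i \in T -> a * (pt i).1 + b * (pt i).2 = c) -> (a, b) = (0, 0).
Proof.
move=> T3 a b c h; apply/eqP; apply: contraT => /eqP ab.
have [] := gpS.1 (imS T) (imS_sub T); first by rewrite card_imS.
by exists a, b, c; split => // p /imfsetP [i iT ->]; exact: h.
Qed.

Lemma pt_no4cocircular (T : {set S}) : #|T| = 4%N -> forall (x : R * R) (rho : R),
  ~ (forall i, i \in T -> sqdist x (pt i) = rho).
Proof.
move=> T4 x rho h.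
have [] := gpS.2 (imS T) (imS_sub T); first by rewrite card_imS.
have /card_gt1P [i [j [iT jT ij]]] : (1 < #|T|)%N by rewrite T4.
(* [cocircular] asks for a positive radius; two distinct points cannot both coincide with x. *)
have rho0 : 0 < rho.
  have [e|xi] := eqVneq x (pt i); last by rewrite -(h i iT) sqdist_gt0.
  by rewrite -(h j jT) sqdist_gt0 // e (inj_eq val_inj).
exists x, (Num.sqrt rho); split; first by rewrite sqrtr_gt0.
by move=> p /imfsetP [k kT ->]; rewrite -(h k kT).
Qed.

Lemma lt_distE (x p q : R * R) : (dist x p < dist x q) = (sqdist x p < sqdist x q).
Proof.
have [h|h] := ltP (sqdist x p) (sqdist x q).
  by rewrite /dist ltr_sqrt //; apply: le_lt_trans h; exact: sqdist_ge0.
by apply/negbTE; rewrite -leNgt /dist; apply: ler_wsqrtr.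
Qed.

Lemma voronoi_cellE (T : {set S}) : voronoi_cell S (imS T) = cell pt T.
Proof.
apply/seteqP; split => x /= h.
  move=> p q pT qT; rewrite -lt_distE; apply: h; first by apply/imfsetP; exists p.
  rewrite in_fsetD (fsvalP q : pt q \in S) andbT; apply/imfsetP => -[j jT /val_inj e].
  by rewrite e jT in qT.
move=> _ q /imfsetP [p pT ->]; rewrite in_fsetD => /andP[qT qS]; rewrite lt_distE.
apply: (h p [` qS]%fset pT); apply: contraNN qT => qT.
by apply/imfsetP; exists [` qS]%fset.
Qed.

Lemma imS_inj : injective imS.
Proof.
move=> T T' e; apply/finset.setP => i.
by move/fsetP/(_ (pt i)): e; rewrite !(mem_imfset _ _ val_inj).
Qed.

Lemma imS_surj (U : {fset R * R}) : (U `<=` S)%fset -> exists T, U = imS T.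
Proof.
move=> /fsubsetP US; exists [set i | pt i \in U]%SET; apply/fsetP => p.
apply/idP/imfsetP => /= [pU|[i + ->]]; last by rewrite inE.
by exists [` US p pU]%fset; rewrite //= inE.
Qed.

Lemma voronoi_vertexE k :
  voronoi_vertex S k = [set x | (3 <= #|near_sets pt k x|)%N].
Proof.
have E x : [fset T in ksubsets S k | `[< closure (voronoi_cell S T) x >]]%fset
    = [fset imS T | T in near_sets pt k x]%fset.
  apply/fsetP => U; rewrite !inE /=; apply/idP/imfsetP => /=.
    move=> /andP[/andP[]]; rewrite fpowersetE => /imS_surj [T ->].
    by rewrite card_imS voronoi_cellE => hT hc; exists T => //; rewrite inE hT.
  move=> [T]; rewrite inE => /andP[hT hc] ->.
  by rewrite fpowersetE imS_sub card_imS hT voronoi_cellE.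
apply/seteqP; split => x; rewrite /voronoi_vertex /= E card_imfset -?cardE //=;
  exact: imS_inj.
Qed.

Lemma voronoi_polyE :
  voronoi_poly S = (1 + 'X) * \sum_(T : {set S} | #|T| == 3%N) 'X^#|inside pt T|.
Proof.
rewrite -(vertices_generating (pt := pt) val_inj pt_no3collinear pt_no4cocircular).
rewrite /voronoi_poly cardfE; apply: eq_bigr => k _.
by rewrite /num_voronoi_vertices voronoi_vertexE.
Qed.
End FsetPoints.

(** * Asymptotics and conclusion *)

Lemma littleo_inv_ln (R : realType) (K : R) : 0 < K ->
  (fun n : nat => K / n%:R : R^o) =o_\oo (fun n : nat => ln n%:R / n%:R : R^o).
Proof.
move=> K0; apply/eqoP => eps eps0.
near=> n.
have hn : expR (K / eps) <= n%:R by near: n; exact: nbhs_infty_ger.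
have n0 : 0 < n%:R :> R by apply: lt_le_trans hn; exact: expR_gt0.
have hln : K / eps <= ln n%:R by rewrite -[leLHS]expRK ler_ln ?posrE ?expR_gt0.
have ln0 : 0 <= ln n%:R :> R by apply: le_trans hln; rewrite divr_ge0 ?ltW.
have a1 : 0 <= K / n%:R by rewrite divr_ge0 ?ltW.
have a2 : 0 <= ln n%:R / n%:R :> R by rewrite divr_ge0 // ltW.
rewrite (ger0_norm a1) (ger0_norm a2) mulrA ler_pdivrMr // divfK ?gt_eqF //.
by rewrite mulrC -ler_pdivrMr.
Unshelve. all: by end_near.
Qed.

Theorem theorem15 (R : realType) (alpha : R) (halpha : 0 < alpha <= 1) :
  exists e : nat -> R^o,
    e =o_\oo (fun n : nat => ln n%:R / n%:R : R^o) /\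
    forall (n : nat) (S : {fset R * R}),
      #|` S| = n ->
      general_position S ->
      (crossing_number S)%:R / 'C(n, 4)%:R = alpha ->
      exists zeta : R[i],
        root (voronoi_poly S) zeta /\ `|1 - zeta| <= (e n)%:C.
Proof.
(* The bound is 1000 / n, so r = 500 / n below. The estimate V r <= 4 (n - 3) with V >= (n - 3)^2 /
   100 - (n - 3) / 2 then fails as soon as n > 265. *)
have [K KE K0] : exists2 K : R, K = 1000 & 0 < K by exists 1000; rewrite ?ltr0n.
exists (fun n => K / n%:R); split; first exact: littleo_inv_ln.
move=> n S Sn gpS ha.
(* For n < 4 the binomial is 0, and division by zero would make alpha equal to 0. *)
have n4 : (3 < n)%N.
  rewrite ltnNge; apply/negP => n3; move: halpha.
  by rewrite -ha bin_small // invr0 mulr0 ltxx.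
have nR : 4 <= n%:R :> R by rewrite ler_nat.
have n0 : 0 < n%:R :> R by lra.
rewrite (voronoi_polyE gpS).
(* For n <= 500 the root -1 of the factor 1 + z suffices, being at distance 2 <= 1000 / n from 1. *)
have [nK|nK] := leqP n 500.
  exists (-1); split; first by rewrite rootE hornerM !hornerE subrr mul0r.
  rewrite opprK le_normsq_norm; last by rewrite divr_ge0 ?ltW.
  have h : n%:R <= 500 :> R by rewrite ler_nat.
  rewrite (_ : normsq _ = 2 ^+ 2); last by rewrite /normsq /=; ring.
  have h2 : 2 <= K / n%:R by rewrite KE ler_pdivlMr //; lra.
  have h3 : 2 ^+ 2 <= (K / n%:R) ^+ 2 :> R by nra.
  exact: h3.
apply: contrapT => hno.
pose s := [seq #|inside (fun i : S => val i) T| | T <- enum [pred T : {set S} | #|T| == 3%N]].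
have IN : #|{: S}| = (n - 3).+3 by rewrite -cardfE Sn; lia.
have N3 : (3 <= n - 3)%N by lia.
have [m0 hs hV] := inside_spread val_inj (pt_no3collinear gpS) (pt_no4cocircular gpS) IN N3 (erefl s).
pose r : R := K / (2 * n%:R).
have r0 : 0 < r by rewrite divr_gt0 // mulr_gt0.
have fE : \sum_(x <- s) 'X^x = \sum_(T : {set S} | #|T| == 3%N) 'X^#|inside (fun i : S => val i) T| :> {poly R[i]}.
  by rewrite big_map big_enum.
have sn0 : s != [::] by rewrite -size_eq0 -lt0n -(ltr0n R).
have hroot z : root (\sum_(x <- s) 'X^x) z -> (2 * r) ^+ 2 <= normsq (1 - z) :> R.
  move=> hz; rewrite leNgt; apply/negP => hlt; apply: hno; exists z; split.
    by rewrite rootM -fE hz orbT.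
  rewrite le_normsq_norm; last by rewrite divr_ge0 ?ltW.
  apply/ltW.
  by rewrite (_ : K / _ = 2 * r) // /r; field; rewrite gt_eqF.
have := sumXn_root_near1 r0 sn0 hs hroot; set V := (X in X * r <= _).
have {}hV : ((n - 3)%:R / 10) ^+ 2 - (n - 3)%:R / 2 <= V by exact: hV.
move: V hV => V hV.
have nKR : 500 < n%:R :> R by rewrite ltr_nat.
have p1 : 0 < n%:R - 3 :> R by lra.
(* After clearing denominators the contradiction amounts to (n - 3)(2n - 530) > 0. *)
have p2 : 0 < 2 * n%:R - 530 :> R by lra.
have p3 := mulr_gt0 p1 p2.
rewrite natrB in hV *; last by rewrite ltnW.
rewrite /r KE mulrA ler_pdivrMr ?mulr_gt0 // leNgt => /negP; apply.
move: hV p3; clear; lra.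
Qed.
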